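(* Let $(U,A)$ be a left Hopf algebroid with translation map $u\mapsto u_+\otimes_{A^{\mathrm{op}}}u_-$, and let $U$ be finitely generated projective as a right $A$-module via the target map, i.e. via $u\cdot a:=t(a)u$. Then the right dual $(U^*,A)$, $U^*=\mathrm{Hom}_{A^{\mathrm{op}}}(U,A)$, carries the structure of a right Hopf algebroid over a right bialgebroid. More precisely, the map $\tilde\beta^{-1}:U^*\to U^*\otimes_{A^{\mathrm{op}}}U^*$ given by $$(\tilde\beta^{-1}(\phi))(u,v)=(u\rightharpoondown\phi)(v):=\varepsilon\big(u_+\,t(\phi(u_-v))\big),\qquad u,v\in U,$$ yields a translation map on $U^*$, that is, the Hopf-Galois map $$\beta:U^*\otimes_{A^{\mathrm{op}}}U^*\to U^*\otimes_A U^*,\qquad \phi\otimes_{A^{\mathrm{op}}}\psi\mapsto\phi\psi^{(1)}\otimes_A\psi^{(2)},$$ is bijective and $\beta^{-1}(1\otimes_A\phi)=\tilde\beta^{-1}(\phi)$ for all $\phi\in U^*$. Explicitly, if $\{e_i\}_{1\le i\le n}\subset U$, $\{e^i\}_{1\le i\le n}\subset U^*$ is a dual basis, the translation map reads $$\phi^-\otimes_{A^{\mathrm{op}}}\phi^+=\sum_i e^i\otimes_{A^{\mathrm{op}}}(e_i\rightharpoondown\phi).$$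
   Context: $k$ is a commutative ring, algebras are unital associative $k$-algebras, $\otimes=\otimes_k$. Left bialgebroid $(U,A)$: a $k$-algebra $U$ with $k$-algebra maps $s:A\to U$ (source) and $t:A^{\mathrm{op}}\to U$ (target) with commuting images, and an $A$-coring structure $\Delta:U\to U\otimes_AU$, $u\mapsto u_{(1)}\otimes_Au_{(2)}$, $\varepsilon:U\to A$, on $U$ with bimodule structure $a\cdot u\cdot b=s(a)t(b)u$, where $U\otimes_AU=U\otimes U/\langle t(a)u\otimes v-u\otimes s(a)v\rangle$. One requires that $\Delta$ takes values in $\{\sum u_i\otimes_A u_i'\mid\sum u_it(a)\otimes_A u'_i=\sum u_i\otimes_A u'_is(a)\ \forall a\in A\}$ and is a unital algebra map into it (factorwise product), $\varepsilon(1)=1$, and $\varepsilon(uv)=\varepsilon(us(\varepsilon(v)))=\varepsilon(ut(\varepsilon(v)))$. A right bialgebroid $(V,B,s^r,t^r,\Delta_r,\partial)$ is the opposite notion: the opposite $(U^{\mathrm{op}},A,t,s,\Delta,\varepsilon)$ of a left bialgebroid is a right bialgebroid. Its coproduct is written $v\mapsto v^{(1)}\otimes_Bv^{(2)}$ and takes values in $V\otimes_BV=V\otimes V/\langle vs^r(b)\otimes w-v\otimes wt^r(b)\rangle$. Left Hopf algebroid: a left bialgebroid such that $U\otimes_{A^{\mathrm{op}}}U\to U\otimes_AU$, $u\otimes v\mapsto u_{(1)}\otimes u_{(2)}v$, is bijective, where $U\otimes_{A^{\mathrm{op}}}U=U\otimes U/\langle ut(a)\otimes v-u\otimes t(a)v\rangle$;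 $u_+\otimes_{A^{\mathrm{op}}}u_-$ denotes the preimage of $u\otimes_A1$. Right Hopf algebroid: a right bialgebroid $(V,B)$ such that $\beta:V\otimes_{B^{\mathrm{op}}}V\to V\otimes_BV$, $v'\otimes v\mapsto v'v^{(1)}\otimes_Bv^{(2)}$, is bijective, where $V\otimes_{B^{\mathrm{op}}}V=V\otimes V/\langle vt^r(b)\otimes w-v\otimes t^r(b)w\rangle$. Its translation map is $v\mapsto v^-\otimes_{B^{\mathrm{op}}}v^+:=\beta^{-1}(1\otimes_Bv)=:\tilde\beta^{-1}(v)$. Right dual: $U^*=\mathrm{Hom}_{A^{\mathrm{op}}}(U,A)=\{\phi:U\to A\ k\text{-linear}\mid\phi(t(a)u)=\phi(u)a\}$. Its structure (when $U$ is finitely generated projective as a right $A$-module via $u\cdot a=t(a)u$) is: $(\phi\psi)(u)=\psi\big(s(\phi(u_{(1)}))u_{(2)}\big)$, unit $\varepsilon$, $s^r(a)(u)=\varepsilon(us(a))$, $t^r(a)(u)=a\varepsilon(u)$, $\partial(\phi)=\phi(1_U)$, and $\Delta_r(\phi)=\phi^{(1)}\otimes_A\phi^{(2)}$ is determined by $\phi^{(1)}\big(u\,t(\phi^{(2)}(v))\big)=\phi(uv)$ for all $u,v\in U$. A dual basis satisfies $u=\sum_it(e^i(u))e_i$ for all $u\in U$. An element $\sum\phi\otimes_{A^{\mathrm{op}}}\psi\in U^*\otimes_{A^{\mathrm{op}}}U^*$ is identified with the map $(u,v)\mapsto\sum\psi\big(s(\phi(u))v\big)$ on $U\otimes_AU$.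 *)

(* Defs.v *)
From HB Require Import structures.
From mathcomp Require Import all_boot all_algebra.
From mathcomp Require Import boolp classical_sets.

Set Implicit Arguments.
Unset Strict Implicit.
Unset Printing Implicit Defensive.

Import GRing.Theory.

Local Open Scope ring_scope.
Local Open Scope quotient_scope.

Section Tensor.
Variables (k : comPzRingType) (M N : lmodType k) (A : Type).
Variables (r : A -> M -> M) (l : A -> N -> N).

(* The list [:: (m_1, n_1); ...; (m_p, n_p)] stands for the sum of the
   m_i (x) n_i. The congruence identifies the lists with the same image in
   (M (x)_k N) / < r a m (x) n - m (x) l a n >, the denominator being the
   k-submodule generated; no inverses are needed because
   - (m (x) n) = (- m) (x) n. *)
Inductive tensor_eq : seq (M * N) -> seq (M * N) -> Prop :=
| tensor_eq_refl s : tensor_eq s s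
| tensor_eq_sym s s' : tensor_eq s s' -> tensor_eq s' s
| tensor_eq_trans s s' s'' :
    tensor_eq s s' -> tensor_eq s' s'' -> tensor_eq s s''
| tensor_eq_cat s1 s1' s2 s2' : tensor_eq s1 s1' -> tensor_eq s2 s2' ->
    tensor_eq (s1 ++ s2) (s1' ++ s2')
| tensor_eq_catC s1 s2 : tensor_eq (s1 ++ s2) (s2 ++ s1)
| tensor_eq_0l n : tensor_eq [:: (0, n)] [::]
| tensor_eq_Dl m m' n :
    tensor_eq [:: (m + m', n)] [:: (m, n); (m', n)]
| tensor_eq_Dr m n n' :
    tensor_eq [:: (m, n + n')] [:: (m, n); (m, n')]
| tensor_eq_Z c m n : tensor_eq [:: (c *: m, n)] [:: (m, c *: n)]
| tensor_eq_bal c a m n :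
    tensor_eq [:: (c *: r a m, n)] [:: (c *: m, l a n)].

Definition tensor_eqb (s s' : seq (M * N)) : bool := `[< tensor_eq s s' >].

Lemma tensor_eqb_equiv : equiv_class_of tensor_eqb.
Proof.
split=> [s|s s'|s' s s''].
- by apply/asboolP; exact: tensor_eq_refl.
- by apply/asboolP/asboolP; exact: tensor_eq_sym.
- by move=> /asboolP ? /asboolP ?; apply/asboolP; apply: tensor_eq_trans; eauto.
Qed.

Canonical tensor_eqb_rel := EquivRelPack tensor_eqb_equiv.
Canonical tensor_eqb_enc := defaultEncModRel tensor_eqb.

Definition tensor := {eq_quot tensor_eqb}.

HB.instance Definition _ : EqQuotient _ tensor_eqb tensor :=
  EqQuotient.on tensor.
HB.instance Definition _ := Choice.on tensor.

Definition tens_seq (s : seq (M * N)) : tensor := \pi_tensor s.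
Definition tens (m : M) (n : N) : tensor := tens_seq [:: (m, n)].

Lemma tens_seqP s s' : tens_seq s = tens_seq s' <-> tensor_eq s s'.
Proof.
rewrite /tens_seq; split.
  by move=> /eqP; rewrite piE => /asboolP.
by move=> ss'; apply/eqP; rewrite piE; apply/asboolP.
Qed.

Lemma tens_seq_repr (T : tensor) : tens_seq (repr T) = T.
Proof. by rewrite /tens_seq reprK. Qed.

Definition tensor_zero : tensor := tens_seq [::].
Definition tensor_add (T T' : tensor) : tensor := tens_seq (repr T ++ repr T').
Definition tensor_scale (c : k) (T : tensor) : tensor :=
  tens_seq [seq (c *: p.1, p.2) | p <- repr T].
Definition tensor_opp : tensor -> tensor := tensor_scale (- 1).

Lemma repr_tens_seq s : tensor_eq (repr (tens_seq s)) s.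
Proof. by apply/tens_seqP; rewrite tens_seq_repr. Qed.

Lemma tens_seq_cat s s' :
  tens_seq (s ++ s') = tensor_add (tens_seq s) (tens_seq s').
Proof.
apply/tens_seqP; apply: tensor_eq_cat; apply: tensor_eq_sym;
  exact: repr_tens_seq.
Qed.

Lemma tensor_eq_scale c s s' : tensor_eq s s' ->
  tensor_eq [seq (c *: p.1, p.2) | p <- s] [seq (c *: p.1, p.2) | p <- s'].
Proof.
elim=> {s s'} /=.
- by move=> s; exact: tensor_eq_refl.
- by move=> s s' _; exact: tensor_eq_sym.
- by move=> s s' s'' _ ss' _; exact: tensor_eq_trans.
- by move=> s1 s1' s2 s2' _ e1 _ e2; rewrite !map_cat; exact: tensor_eq_cat.
- by move=> s1 s2; rewrite !map_cat; exact: tensor_eq_catC.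
- by move=> n; rewrite scaler0; exact: tensor_eq_0l.
- by move=> m m' n; rewrite scalerDr; exact: tensor_eq_Dl.
- by move=> m n n'; exact: tensor_eq_Dr.
- by move=> d m n; rewrite scalerA mulrC -scalerA; exact: tensor_eq_Z.
- by move=> d a m n; rewrite !scalerA; exact: tensor_eq_bal.
Qed.

Lemma tens_seq_scale c s :
  tens_seq [seq (c *: p.1, p.2) | p <- s] = tensor_scale c (tens_seq s).
Proof.
apply/tens_seqP; apply: tensor_eq_scale; apply: tensor_eq_sym.
exact: repr_tens_seq.
Qed.

Lemma tensor_addA : associative tensor_add.
Proof.
move=> x y z; rewrite -[x]tens_seq_repr -[y]tens_seq_repr -[z]tens_seq_repr.
by rewrite -!tens_seq_cat catA.
Qed.

Lemma tensor_addC : commutative tensor_add.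
Proof. by move=> x y; apply/tens_seqP; exact: tensor_eq_catC. Qed.

Lemma tensor_add0 : left_id tensor_zero tensor_add.
Proof. by move=> x; rewrite -[x]tens_seq_repr -tens_seq_cat. Qed.

Lemma tens_seq_cons p s :
  tens_seq (p :: s) = tensor_add (tens p.1 p.2) (tens_seq s).
Proof. by case: p => m n; rewrite -tens_seq_cat. Qed.

Lemma tensor_scaleDl_subproof T :
  {morph tensor_scale^~ T : c d / c + d >-> tensor_add c d}.
Proof.
move=> c d; rewrite -[T]tens_seq_repr; elim: (repr T) => [|p s IHs].
  by rewrite -!tens_seq_scale /= -tens_seq_cat.
rewrite -!tens_seq_scale /= !tens_seq_cons !tens_seq_scale IHs /=.
have -> : tens ((c + d) *: p.1) p.2 =
    tensor_add (tens (c *: p.1) p.2) (tens (d *: p.1) p.2).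
  by rewrite -tens_seq_cat scalerDl; apply/tens_seqP; exact: tensor_eq_Dl.
set a := tens _ _; set b := tens _ _; set x := tensor_scale _ _.
set y := tensor_scale _ _; rewrite -!tensor_addA; congr tensor_add.
by rewrite !tensor_addA [tensor_add b x]tensor_addC.
Qed.

Lemma tensor_scale1_subproof : left_id 1 tensor_scale.
Proof.
move=> T; rewrite -[T]tens_seq_repr -tens_seq_scale; congr tens_seq.
by rewrite -[RHS]map_id; apply: eq_map => -[m n]; rewrite scale1r.
Qed.

Lemma tensor_scale0_subproof T : tensor_scale 0 T = tensor_zero.
Proof.
rewrite -[T]tens_seq_repr -tens_seq_scale; elim: (repr T) => [//|p s IHs] /=.
rewrite tens_seq_cons IHs tensor_addC tensor_add0 /=; apply/tens_seqP.
by rewrite scale0r; exact: tensor_eq_0l.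
Qed.

Lemma tensor_addN : left_inverse tensor_zero tensor_opp tensor_add.
Proof.
move=> T; rewrite -{2}[T]tensor_scale1_subproof -tensor_scaleDl_subproof.
by rewrite addNr tensor_scale0_subproof.
Qed.

HB.instance Definition _ := GRing.isZmodule.Build tensor
  tensor_addA tensor_addC tensor_add0 tensor_addN.

Lemma tensor_scaleA_subproof c d T :
  tensor_scale c (tensor_scale d T) = tensor_scale (c * d) T.
Proof.
rewrite -[T]tens_seq_repr -!tens_seq_scale -map_comp; congr tens_seq.
by apply: eq_map => -[m n] /=; rewrite scalerA.
Qed.

Lemma tensor_scaleDr_subproof c : {morph tensor_scale c : T T' / T + T'}.
Proof.
move=> T T'; rewrite -[T]tens_seq_repr -[T']tens_seq_repr.
by rewrite /GRing.add /= -tens_seq_cat -!tens_seq_scale map_cat tens_seq_cat.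
Qed.

HB.instance Definition _ := GRing.Zmodule_isLmodule.Build k tensor
  tensor_scaleA_subproof tensor_scale1_subproof tensor_scaleDr_subproof
  tensor_scaleDl_subproof.

Lemma tensDl m m' n : tens (m + m') n = tens m n + tens m' n.
Proof.
by rewrite [RHS]/GRing.add /= -tens_seq_cat; apply/tens_seqP; exact: tensor_eq_Dl.
Qed.

Lemma tensDr m n n' : tens m (n + n') = tens m n + tens m n'.
Proof.
by rewrite [RHS]/GRing.add /= -tens_seq_cat; apply/tens_seqP; exact: tensor_eq_Dr.
Qed.

Lemma tensZl c m n : tens (c *: m) n = c *: tens m n.
Proof. by rewrite [RHS]/GRing.scale /= -tens_seq_scale. Qed.

Lemma tensZr c m n : tens m (c *: n) = c *: tens m n.
Proof. by rewrite -tensZl; apply/esym/tens_seqP; exact: tensor_eq_Z. Qed.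

Lemma tens_bal a m n : tens (r a m) n = tens m (l a n).
Proof.
by rewrite -[r a m]scale1r -[m in RHS]scale1r; apply/tens_seqP; exact: tensor_eq_bal.
Qed.

Lemma tens_seqE s : tens_seq s = \sum_(p <- s) tens p.1 p.2.
Proof.
elim: s => [|p s IHs]; first by rewrite big_nil.
by rewrite big_cons -IHs tens_seq_cons.
Qed.

Lemma tensorE (T : tensor) : T = \sum_(p <- repr T) tens p.1 p.2.
Proof. by rewrite -tens_seqE tens_seq_repr. Qed.

Definition balanced (W : lmodType k) (f : M -> N -> W) : Prop :=
  [/\ forall n, linear (f^~ n), forall m, linear (f m)
    & forall a m n, f (r a m) n = f m (l a n)].

(* [tlift f T] is the value at T of the linear map induced by a balanced f;
   written tlift (fun m n => E) T, it is the Sweedler-style sum of the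
   E(m_i, n_i) for T = sum_i m_i (x) n_i. It is only meaningful for balanced f,
   cf. [tliftE] and [tlift_linear]. *)
Definition tlift (W : lmodType k) (f : M -> N -> W) (T : tensor) : W :=
  \sum_(p <- repr T) f p.1 p.2.

Section Lift.
Variables (W : lmodType k) (f : M -> N -> W).
Hypothesis fP : balanced f.

Let fDl m m' n : f (m + m') n = f m n + f m' n.
Proof. by case: fP => fl _ _; have := fl n 1 m m'; rewrite !scale1r. Qed.

Let fDr m n n' : f m (n + n') = f m n + f m n'.
Proof. by case: fP => _ fr _; have := fr m 1 n n'; rewrite !scale1r. Qed.

Let f0l n : f 0 n = 0.
Proof. by apply: (addrI (f 0 n)); rewrite -fDl !addr0. Qed.

Let f0r m : f m 0 = 0.
Proof. by apply: (addrI (f m 0)); rewrite -fDr !addr0. Qed.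

Let fZl c m n : f (c *: m) n = c *: f m n.
Proof.
by case: fP => fl _ _; have := fl n c m 0; rewrite !addr0 f0l addr0.
Qed.

Let fZr c m n : f m (c *: n) = c *: f m n.
Proof.
by case: fP => _ fr _; have := fr m c n 0; rewrite !addr0 f0r addr0.
Qed.

Lemma tensor_eq_sum s s' : tensor_eq s s' ->
  \sum_(p <- s) f p.1 p.2 = \sum_(p <- s') f p.1 p.2.
Proof.
elim=> // {s s'}.
- by move=> s1 s2 s3 _ -> _ ->.
- by move=> s1 s1' s2 s2' _ e1 _ e2; rewrite !big_cat /= e1 e2.
- by move=> s1 s2; rewrite !big_cat /= addrC.
- by move=> n; rewrite big_seq1 big_nil /= f0l.
- by move=> m m' n; rewrite !big_cons !big_nil /= !addr0 fDl.
- by move=> m n n'; rewrite !big_cons !big_nil /= !addr0 fDr.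
- by move=> c m n; rewrite !big_seq1 /= fZl fZr.
- by move=> c a m n; rewrite !big_seq1 /= !fZl; case: fP => _ _ ->.
Qed.

Lemma tlift_seq s : tlift f (tens_seq s) = \sum_(p <- s) f p.1 p.2.
Proof. exact/tensor_eq_sum/repr_tens_seq. Qed.

Lemma tliftE m n : tlift f (tens m n) = f m n.
Proof. by rewrite tlift_seq big_seq1. Qed.

Lemma tlift_linear : linear (tlift f).
Proof.
move=> c T T'; rewrite -[T]tens_seq_repr -[T']tens_seq_repr.
rewrite [X in X + _]/GRing.scale /= -tens_seq_scale.
rewrite [X in tlift f X]/GRing.add /= -tens_seq_cat !tlift_seq big_cat big_map /=.
by rewrite scaler_sumr; congr (_ + _); apply: eq_bigr => p _; rewrite fZl.
Qed.

End Lift.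
End Tensor.

Arguments tens {k M N A r l} m n.
Arguments tlift {k M N A r l W} f T.

Lemma raddf_tlift (k : comPzRingType) (M N W W' : lmodType k) (A : Type)
    (r : A -> M -> M) (l : A -> N -> N) (h : W -> W') (f : M -> N -> W)
    (T : tensor r l) :
  linear h -> h (tlift f T) = tlift (fun m n => h (f m n)) T.
Proof.
move=> h_lin; have hD x y : h (x + y) = h x + h y.
  by have := h_lin 1 x y; rewrite !scale1r.
rewrite /tlift; apply: (big_morph h hD).
by apply: (addrI (h 0)); rewrite -hD !addr0.
Qed.

Lemma eq_tlift (k : comPzRingType) (M N W : lmodType k) (A : Type)
    (r : A -> M -> M) (l : A -> N -> N) (f g : M -> N -> W) (T : tensor r l) :
  (forall m n, f m n = g m n) -> tlift f T = tlift g T.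
Proof. by move=> fg; apply: eq_bigr => p _. Qed.

Lemma tensor_ind (k : comPzRingType) (M N : lmodType k) (A : Type)
    (r : A -> M -> M) (l : A -> N -> N) (P : tensor r l -> Prop) :
  P 0 -> (forall m n, P (tens m n)) ->
  (forall T T', P T -> P T' -> P (T + T')) -> forall T, P T.
Proof.
by move=> P0 Pt PD T; rewrite [T]tensorE; elim/big_ind: _ => // p _; exact: Pt.
Qed.

Definition lact (B : Type) (U : pzRingType) (f : B -> U) (b : B) (u : U) : U :=
  f b * u.
Definition ract (B : Type) (U : pzRingType) (f : B -> U) (b : B) (u : U) : U :=
  u * f b.

Section TripleTensor.
Variables (k : comPzRingType) (M : lmodType k) (A : Type).
Variables (r l : A -> M -> M).

Definition tensor_lact (a : A) (T : tensor r l) : tensor r l :=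
  tlift (fun m n => tens (l a m) n) T.

(* M (x)_A (M (x)_A M) *)
Definition tensor3 := tensor r tensor_lact.
HB.instance Definition _ := GRing.Lmodule.on tensor3.

(* The left hand side is (D (x) id) D composed with the associativity
   isomorphism. *)
Definition coassociative (D : M -> tensor r l) : Prop :=
  forall m,
    tlift (fun m1 m2 => tlift (fun x y => tens x (tens y m2)) (D m1)) (D m)
    = tlift (fun m1 m2 => tens m1 (D m2)) (D m) :> tensor3.
End TripleTensor.

(* In each [tlift] below the function is balanced; for [lcoprodM] this holds
   for the inner one for all v1, v2, and for the outer one by [lcoprod_takeuchi]. *)
Record leftBialgebroid (k : comPzRingType) (A U : algType k) :=
  LeftBialgebroid {
  lsrc : {lrmorphism A -> U};
  ltgt : {rmorphism A^c -> U};
  ltgtZ : forall (c : k) (a : A), ltgt (c *: a) = c *: ltgt a;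
  lsrc_tgt : forall a b : A, lsrc a * ltgt b = ltgt b * lsrc a;
  lcoprod : {linear U -> tensor (lact (ltgt : A -> U)) (lact lsrc)};
  lcounit : {linear U -> A};
  lcoprod_bimod : forall (a b : A) (u : U),
    lcoprod (lsrc a * ltgt b * u) =
    tlift (fun u1 u2 => tens (lsrc a * u1) (ltgt b * u2)) (lcoprod u);
  lcounit_bimod : forall (a b : A) (u : U),
    lcounit (lsrc a * ltgt b * u) = a * lcounit u * b;
  lcoassoc : coassociative lcoprod;
  lcounit_l : forall u,
    tlift (fun u1 u2 => lsrc (lcounit u1) * u2) (lcoprod u) = u;
  lcounit_r : forall u,
    tlift (fun u1 u2 => ltgt (lcounit u2) * u1) (lcoprod u) = u;
  lcoprod_takeuchi : forall (u : U) (a : A),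
    tlift (fun u1 u2 => tens (u1 * ltgt a) u2) (lcoprod u) =
    tlift (fun u1 u2 => tens u1 (u2 * lsrc a)) (lcoprod u)
      :> tensor (lact (ltgt : A -> U)) (lact lsrc);
  lcoprod1 : lcoprod 1 = tens 1 1;
  lcoprodM : forall u v : U,
    lcoprod (u * v) =
    tlift (fun v1 v2 =>
      tlift (fun u1 u2 => tens (u1 * v1) (u2 * v2)) (lcoprod u)) (lcoprod v);
  lcounit1 : lcounit 1 = 1;
  lcounitMs : forall u v : U,
    lcounit (u * v) = lcounit (u * lsrc (lcounit v));
  lcounitMt : forall u v : U,
    lcounit (u * v) = lcounit (u * ltgt (lcounit v))
}.

(* The axioms of a left bialgebroid, read in the opposite algebra and with
   source and target exchanged. *)
Record rightBialgebroid (k : comPzRingType) (B V : algType k) :=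
  RightBialgebroid {
  rsrc : {lrmorphism B -> V};
  rtgt : {rmorphism B^c -> V};
  rtgtZ : forall (c : k) (b : B), rtgt (c *: b) = c *: rtgt b;
  rsrc_tgt : forall a b : B, rsrc a * rtgt b = rtgt b * rsrc a;
  rcoprod : {linear V -> tensor (ract rsrc) (ract (rtgt : B -> V))};
  rcounit : {linear V -> B};
  rcoprod_bimod : forall (a b : B) (v : V),
    rcoprod (v * (rtgt a * rsrc b)) =
    tlift (fun v1 v2 => tens (v1 * rtgt a) (v2 * rsrc b)) (rcoprod v);
  rcounit_bimod : forall (a b : B) (v : V),
    rcounit (v * (rtgt a * rsrc b)) = a * rcounit v * b;
  rcoassoc : coassociative rcoprod;
  rcounit_l : forall v,
    tlift (fun v1 v2 => v2 * rtgt (rcounit v1)) (rcoprod v) = v;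
  rcounit_r : forall v,
    tlift (fun v1 v2 => v1 * rsrc (rcounit v2)) (rcoprod v) = v;
  rcoprod_takeuchi : forall (v : V) (b : B),
    tlift (fun v1 v2 => tens (rsrc b * v1) v2) (rcoprod v) =
    tlift (fun v1 v2 => tens v1 (rtgt b * v2)) (rcoprod v)
      :> tensor (ract rsrc) (ract (rtgt : B -> V));
  rcoprod1 : rcoprod 1 = tens 1 1;
  rcoprodM : forall v w : V,
    rcoprod (v * w) =
    tlift (fun v1 v2 =>
      tlift (fun w1 w2 => tens (v1 * w1) (v2 * w2)) (rcoprod w)) (rcoprod v);
  rcounit1 : rcounit 1 = 1;
  rcounitMs : forall v w : V,
    rcounit (v * w) = rcounit (rsrc (rcounit v) * w);
  rcounitMt : forall v w : V,
    rcounit (v * w) = rcounit (rtgt (rcounit v) * w)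
}.

Section LeftHopf.
Variables (k : comPzRingType) (A U : algType k) (H : leftBialgebroid A U).
Local Notation s := (lsrc H).
Local Notation t := (ltgt H).

(* U (x)_A U and U (x)_{A^op} U *)
Definition ltens := tensor (lact (t : A -> U)) (lact s).
Definition ltens_op := tensor (ract (t : A -> U)) (lact (t : A -> U)).
HB.instance Definition _ := GRing.Lmodule.on ltens.
HB.instance Definition _ := GRing.Lmodule.on ltens_op.

Definition lgalois (T : ltens_op) : ltens :=
  tlift (fun u v => tlift (fun u1 u2 => tens u1 (u2 * v)) (lcoprod H u)) T.

Definition is_left_Hopf : Prop := bijective lgalois.

(* u_+ (x) u_-, the preimage of u (x) 1 when H is left Hopf *)
Definition ltranslation (u : U) : ltens_op :=
  xget 0 [set T : ltens_op | lgalois T = tens u 1].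

Lemma ltranslationP u : is_left_Hopf -> lgalois (ltranslation u) = tens u 1.
Proof.
case=> g _ gK; apply: (@xgetPex _ 0 [set T : ltens_op | lgalois T = tens u 1]).
by exists (g (tens u 1)); exact: gK.
Qed.

End LeftHopf.

Section RightHopf.
Variables (k : comPzRingType) (B V : algType k) (R : rightBialgebroid B V).

(* V (x)_B V and V (x)_{B^op} V *)
Definition rtens := tensor (ract (rsrc R)) (ract (rtgt R : B -> V)).
Definition rtens_op := tensor (ract (rtgt R : B -> V)) (lact (rtgt R : B -> V)).
HB.instance Definition _ := GRing.Lmodule.on rtens.
HB.instance Definition _ := GRing.Lmodule.on rtens_op.

Definition rgalois (T : rtens_op) : rtens :=
  tlift (fun v' v => tlift (fun v1 v2 => tens (v' * v1) v2) (rcoprod R v)) T.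

Definition is_right_Hopf : Prop := bijective rgalois.

(* v^- (x) v^+, the preimage of 1 (x) v when R is right Hopf *)
Definition rtranslation (v : V) : rtens_op :=
  xget 0 [set T : rtens_op | rgalois T = tens 1 v].

Lemma rtranslationP v : is_right_Hopf -> rgalois (rtranslation v) = tens 1 v.
Proof.
case=> g _ gK; apply: (@xgetPex _ 0 [set T : rtens_op | rgalois T = tens 1 v]).
by exists (g (tens 1 v)); exact: gK.
Qed.

End RightHopf.

Definition finitely_generated (R : pzRingType) (P : lmodType R) : Prop :=
  exists (n : nat) (e : 'I_n -> P),
    forall u : P, exists c : 'I_n -> R, u = \sum_(i < n) c i *: e i.

Definition projective (R : pzRingType) (P : lmodType R) : Prop :=
  forall (M N : lmodType R) (g : {linear M -> N}) (f : {linear P -> N}),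
    (forall y, exists x, g x = y) ->
  exists h : {linear P -> M}, forall u, g (h u) = f u.

(* U as a right A-module, i.e. a left module over the converse ring A^c, via
   u . a := t(a) u. *)
Definition tgt_mod (k : comPzRingType) (A U : algType k)
  (H : leftBialgebroid A U) : Type := U.

Section TargetModule.
Variables (k : comPzRingType) (A U : algType k) (H : leftBialgebroid A U).

HB.instance Definition _ := GRing.Zmodule.on (tgt_mod H).

Definition tgt_scale (a : A^c) (u : tgt_mod H) : tgt_mod H :=
  ltgt H a * (u : U).

Lemma tgt_scaleA a b u : tgt_scale a (tgt_scale b u) = tgt_scale (a * b) u.
Proof. by rewrite /tgt_scale rmorphM mulrA. Qed.
Lemma tgt_scale1 : left_id 1 tgt_scale.
Proof. by move=> u; rewrite /tgt_scale rmorph1 mul1r. Qed.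
Lemma tgt_scaleDr : right_distributive tgt_scale +%R.
Proof. by move=> a u v; exact: (@mulrDr U). Qed.
Lemma tgt_scaleDl u : {morph tgt_scale^~ u : a b / a + b}.
Proof. by move=> a b; rewrite /tgt_scale rmorphD mulrDl. Qed.

HB.instance Definition _ := GRing.Zmodule_isLmodule.Build A^c (tgt_mod H)
  tgt_scaleA tgt_scale1 tgt_scaleDr tgt_scaleDl.
End TargetModule.

Record rdual (k : comPzRingType) (A U : algType k) (H : leftBialgebroid A U) :=
  RDual {
  rdual_fun :> U -> A;
  rdual_linear : linear rdual_fun;
  rdualP : forall (a : A) (u : U), rdual_fun (ltgt H a * u) = rdual_fun u * a
}.

Section RightDual.
Variables (k : comPzRingType) (A U : algType k) (H : leftBialgebroid A U).
Local Notation s := (lsrc H).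
Local Notation t := (ltgt H).
Local Notation D := (lcoprod H).
Local Notation eps := (lcounit H).
Local Notation dual := (rdual H).

Implicit Types (phi psi chi : dual) (u v : U) (a : A).

HB.instance Definition _ := gen_eqMixin dual.
HB.instance Definition _ := gen_choiceMixin dual.

HB.instance Definition _ phi :=
  GRing.isLinear.Build k U A *:%R (rdual_fun phi) (rdual_linear phi).

Lemma rdual_eqP phi psi : (forall u, phi u = psi u) -> phi = psi.
Proof.
case: phi psi => [f flin fP] [g glin gP] /= /funext fg; move: flin fP glin gP.
rewrite {}fg => ? ? ? ?.
by congr RDual; exact: Prop_irrelevance.
Qed.

Section Constructions.
Variables (phi psi : dual) (c : k).

Lemma rdual_zero_linear : linear (fun _ : U => 0 : A).
Proof. by move=> d u v; rewrite scaler0 addr0. Qed.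
Lemma rdual_zeroP a u : (0 : A) = 0 * a. Proof. by rewrite mul0r. Qed.
Definition rdual_zero : dual := @RDual _ _ _ H _ rdual_zero_linear rdual_zeroP.

Lemma rdual_add_linear : linear (fun u => phi u + psi u).
Proof. by move=> d u v; rewrite !linearP scalerDr addrACA. Qed.
Lemma rdual_addP a u : phi (t a * u) + psi (t a * u) = (phi u + psi u) * a.
Proof. by rewrite !rdualP mulrDl. Qed.
Definition rdual_add : dual := RDual rdual_add_linear rdual_addP.

Lemma rdual_opp_linear : linear (fun u => - phi u).
Proof. by move=> d u v; rewrite linearP opprD scalerN. Qed.
Lemma rdual_oppP a u : - phi (t a * u) = - phi u * a.
Proof. by rewrite rdualP mulNr. Qed.
Definition rdual_opp : dual := RDual rdual_opp_linear rdual_oppP.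

Lemma rdual_scale_linear : linear (fun u => c *: phi u).
Proof. by move=> d u v; rewrite linearP scalerDr !scalerA mulrC. Qed.
Lemma rdual_scaleP a u : c *: phi (t a * u) = c *: phi u * a.
Proof. by rewrite rdualP scalerAl. Qed.
Definition rdual_scale : dual := RDual rdual_scale_linear rdual_scaleP.
End Constructions.

Lemma rdual_addA : associative rdual_add.
Proof. by move=> f g h; apply: rdual_eqP => u /=; rewrite addrA. Qed.
Lemma rdual_addC : commutative rdual_add.
Proof. by move=> f g; apply: rdual_eqP => u /=; rewrite addrC. Qed.
Lemma rdual_add0 : left_id rdual_zero rdual_add.
Proof. by move=> f; apply: rdual_eqP => u /=; rewrite add0r. Qed.
Lemma rdual_addN : left_inverse rdual_zero rdual_opp rdual_add.
Proof. by move=> f; apply: rdual_eqP => u /=; rewrite addNr. Qed.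

HB.instance Definition _ := GRing.isZmodule.Build dual
  rdual_addA rdual_addC rdual_add0 rdual_addN.

Lemma rdual_scaleA c d phi :
  rdual_scale (rdual_scale phi d) c = rdual_scale phi (c * d).
Proof. by apply: rdual_eqP => u /=; rewrite scalerA. Qed.
Lemma rdual_scale1 : left_id 1 (fun c phi => rdual_scale phi c).
Proof. by move=> f; apply: rdual_eqP => u /=; rewrite scale1r. Qed.
Lemma rdual_scaleDr :
  right_distributive (fun c phi => rdual_scale phi c) +%R.
Proof. by move=> c f g; apply: rdual_eqP => u /=; rewrite scalerDr. Qed.
Lemma rdual_scaleDl phi :
  {morph (fun c => rdual_scale phi c) : c d / c + d}.
Proof. by move=> c d; apply: rdual_eqP => u /=; rewrite scalerDl. Qed.

HB.instance Definition _ := GRing.Zmodule_isLmodule.Build k dual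
  rdual_scaleA rdual_scale1 rdual_scaleDr rdual_scaleDl.

Lemma lcoprod_tgt a u :
  D (t a * u) = tlift (fun u1 u2 => tens u1 (t a * u2)) (D u).
Proof.
have := lcoprod_bimod H 1 a u; rewrite rmorph1 mul1r => ->.
by apply: eq_tlift => x y; rewrite mul1r.
Qed.

Lemma lcoprod_src a u :
  D (s a * u) = tlift (fun u1 u2 => tens (s a * u1) u2) (D u).
Proof.
have := lcoprod_bimod H a 1 u; rewrite rmorph1 mulr1 => ->.
by apply: eq_tlift => x y; rewrite mul1r.
Qed.

Lemma lcounit_tgt a u : eps (t a * u) = eps u * a.
Proof. by have := lcounit_bimod H 1 a u; rewrite rmorph1 !mul1r. Qed.

Lemma lcounit_src a u : eps (s a * u) = a * eps u.
Proof. by have := lcounit_bimod H a 1 u; rewrite rmorph1 !mulr1. Qed.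

Lemma rdual_one_linear : linear eps.
Proof. exact: linearP. Qed.

Definition rdual_one : dual := RDual rdual_one_linear lcounit_tgt.

Definition rdual_mul_fun phi psi (u : U) : A :=
  tlift (fun u1 u2 => psi (s (phi u1) * u2)) (D u).

Lemma rdual_mul_balanced phi psi :
  balanced (lact (t : A -> U)) (lact s) (fun u1 u2 => psi (s (phi u1) * u2)).
Proof.
split=> [v c x y|u c x y|a x y] /=.
- by rewrite !linearP mulrDl -scalerAl linearP.
- by rewrite mulrDr -scalerAr linearP.
- by rewrite /lact rdualP rmorphM mulrA.
Qed.

Lemma rdual_mul_linear phi psi : linear (rdual_mul_fun phi psi).
Proof.
move=> c u v; rewrite /rdual_mul_fun linearP.
exact: (tlift_linear (rdual_mul_balanced phi psi)).
Qed.

Lemma rdual_mulP phi psi a u :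
  rdual_mul_fun phi psi (t a * u) = rdual_mul_fun phi psi u * a.
Proof.
rewrite /rdual_mul_fun lcoprod_tgt.
have fP := rdual_mul_balanced phi psi.
rewrite (raddf_tlift _ _ (tlift_linear fP)).
rewrite [RHS](@raddf_tlift _ _ _ _ _ _ _ _ (fun x : A => x * a)); last first.
  by move=> c x y; rewrite mulrDl scalerAl.
apply: eq_tlift => x y; rewrite tliftE //.
by rewrite mulrA lsrc_tgt -mulrA rdualP.
Qed.

Definition rdual_mul phi psi : dual :=
  RDual (rdual_mul_linear phi psi) (rdual_mulP phi psi).

Lemma rdual_mulA : associative rdual_mul.
Proof.
move=> phi psi chi; apply: rdual_eqP => u /=.
rewrite /rdual_mul_fun /= /rdual_mul_fun.
pose G (x : U) (T : tensor (lact (t : A -> U)) (lact s)) : A :=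
  tlift (fun y z => chi (s (psi (s (phi x) * y)) * z)) T.
have g_bal x : balanced (lact (t : A -> U)) (lact s)
    (fun y z => chi (s (psi (s (phi x) * y)) * z)).
  split=> [z c y y'|y c z z'|a y z] /=.
  - by rewrite mulrDr -scalerAr !linearP mulrDl -scalerAl linearP.
  - by rewrite mulrDr -scalerAr linearP.
  - by rewrite /lact mulrA lsrc_tgt -mulrA rdualP rmorphM mulrA.
have G_lin x : linear (G x) by exact: tlift_linear.
have G_bal : balanced (lact (t : A -> U))
    (@tensor_lact _ _ _ (lact (t : A -> U)) (lact s)) G.
  split=> [T c x y|x|a x T] /=.
  - rewrite /G /tlift scaler_sumr -big_split; apply: eq_bigr => -[m n] _ /=.
    by do 3!rewrite ?mulrDl -?scalerAl ?linearP.
  - exact: G_lin.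
  - rewrite /tensor_lact (raddf_tlift _ _ (G_lin x)) /G.
    by apply: eq_tlift => y z; rewrite tliftE // /lact rdualP rmorphM -mulrA.
have := congr1 (tlift G) (lcoassoc H u).
rewrite !(raddf_tlift _ _ (tlift_linear G_bal)) => coassoc.
transitivity (tlift (fun m1 m2 => tlift G
    (tens m1 (D m2) : tensor3 (lact (t : A -> U)) (lact s))) (D u)).
  apply: eq_tlift => x y; rewrite tliftE // lcoprod_src.
  rewrite (raddf_tlift _ _ (tlift_linear (rdual_mul_balanced psi chi))).
  by apply: eq_tlift => y1 y2; rewrite tliftE //; exact: rdual_mul_balanced.
rewrite -coassoc; apply: eq_tlift => x y.
rewrite (raddf_tlift _ _ (tlift_linear G_bal)).
rewrite (@raddf_tlift _ _ _ _ _ _ _ _ (fun a : A => chi (s a * y))); last first.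
  by move=> c a b /=; rewrite linearP mulrDl -scalerAl linearP.
by apply: eq_tlift => x1 x2; rewrite tliftE // /G tliftE.
Qed.

Lemma rdual_mul1 : left_id rdual_one rdual_mul.
Proof.
move=> phi; apply: rdual_eqP => u /=; rewrite -[in RHS](lcounit_l H u).
by rewrite (raddf_tlift _ _ (rdual_linear phi)).
Qed.

Lemma rdual_mulr1 : right_id rdual_one rdual_mul.
Proof.
move=> phi; apply: rdual_eqP => u /=; rewrite -[in RHS](lcounit_r H u).
rewrite (raddf_tlift _ _ (rdual_linear phi)); apply: eq_tlift => x y /=.
by rewrite lcounit_src rdualP.
Qed.

Lemma rdual_mulDl : left_distributive rdual_mul +%R.
Proof.
move=> f g h; apply: rdual_eqP => u /=.
rewrite /rdual_mul_fun /tlift -big_split; apply: eq_bigr => -[x y] _ /=.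
by rewrite linearD mulrDl linearD.
Qed.

Lemma rdual_mulDr : right_distributive rdual_mul +%R.
Proof.
move=> f g h; apply: rdual_eqP => u /=.
by rewrite /rdual_mul_fun /tlift -big_split.
Qed.

Lemma rdual_one_neq0 : rdual_one != 0 :> dual.
Proof.
apply/eqP => /(congr1 (fun f : dual => f 1)) /= /eqP.
by rewrite lcounit1 oner_eq0.
Qed.

HB.instance Definition _ := GRing.Zmodule_isNzRing.Build dual
  rdual_mulA rdual_mul1 rdual_mulr1 rdual_mulDl rdual_mulDr rdual_one_neq0.

Lemma rdual_scaleAl (c : k) phi psi : c *: (phi * psi) = c *: phi * psi.
Proof.
apply: rdual_eqP => u /=; rewrite /rdual_mul_fun /tlift scaler_sumr.
by apply: eq_bigr => -[x y] _ /=; rewrite linearZ /= -scalerAl linearZ.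
Qed.

HB.instance Definition _ := GRing.Lmodule_isLalgebra.Build k dual rdual_scaleAl.

Lemma rdual_scaleAr (c : k) phi psi : c *: (phi * psi) = phi * (c *: psi).
Proof.
by apply: rdual_eqP => u /=; rewrite /rdual_mul_fun /tlift scaler_sumr.
Qed.

HB.instance Definition _ := GRing.Lalgebra_isAlgebra.Build k dual rdual_scaleAr.

Lemma rdual_mulE phi psi u :
  (phi * psi) u = tlift (fun u1 u2 => psi (s (phi u1) * u2)) (D u).
Proof. by []. Qed.

Lemma rdual_oneE u : (1 : dual) u = eps u.
Proof. by []. Qed.

Lemma rdual_addE phi psi u : (phi + psi) u = phi u + psi u.
Proof. by []. Qed.

Lemma rdual_scaleE (c : k) phi u : (c *: phi) u = c *: phi u.
Proof. by []. Qed.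

Hypothesis hopf : is_left_Hopf H.
Local Notation tr := (ltranslation H).

Definition rharp_fun u phi (v : U) : A :=
  tlift (fun x y => eps (x * t (phi (y * v)))) (tr u).

Lemma rharp_balanced phi v :
  balanced (ract (t : A -> U)) (lact (t : A -> U))
    (fun x y => eps (x * t (phi (y * v)))).
Proof.
split=> [y c x x'|x c y y'|a x y] /=.
- by rewrite mulrDl -scalerAl linearP.
- by rewrite mulrDl -scalerAl linearP rmorphD ltgtZ mulrDr -scalerAr linearP.
- by rewrite /ract /lact -[t a * y * v]mulrA rdualP rmorphM mulrA.
Qed.

Lemma rharp_linear u phi : linear (rharp_fun u phi).
Proof.
move=> c v w; rewrite /rharp_fun /tlift scaler_sumr -big_split.
apply: eq_bigr => -[x y] _ /=.
by rewrite mulrDr -scalerAr linearP rmorphD ltgtZ mulrDr -scalerAr linearP.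
Qed.

Lemma lgalois_bal1 v : balanced (lact (t : A -> U)) (lact s)
  (fun u1 u2 => tens u1 (u2 * v) : ltens H).
Proof.
split=> [y c x x'|x c y y'|a x y] /=.
- by rewrite tensDl tensZl.
- by rewrite mulrDl -scalerAl tensDr tensZr.
- by rewrite tens_bal /lact mulrA.
Qed.

Lemma lcoprodMtgt u a :
  D (u * t a) = tlift (fun u1 u2 => tens u1 (u2 * t a)) (D u).
Proof.
have -> : D (u * t a) = tlift (fun v1 v2 =>
   tlift (fun u1 u2 => tens (u1 * v1) (u2 * v2)) (D u)) (tens 1 (t a) : ltens H).
  rewrite lcoprodM; congr tlift.
  have := lcoprod_tgt a 1; rewrite mulr1 => ->; rewrite lcoprod1 tliftE ?mulr1 //.
  split=> [y c x x'|x c y y'|b x y] /=.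
  - by rewrite tensDl tensZl.
  - by rewrite mulrDr -scalerAr tensDr tensZr.
  - by rewrite tens_bal /lact !mulrA lsrc_tgt.
rewrite tliftE; first by apply: eq_tlift => x y; rewrite mulr1.
split=> [y c x x'|x c y y'|b x y] /=.
- rewrite /tlift scaler_sumr -big_split; apply: eq_bigr => -[m n] _ /=.
  by rewrite mulrDr -scalerAr tensDl tensZl.
- rewrite /tlift scaler_sumr -big_split; apply: eq_bigr => -[m n] _ /=.
  by rewrite mulrDr -scalerAr tensDr tensZr.
- pose F m n : ltens H := tens (m * x) (n * y).
  have F_bal : balanced (lact (t : A -> U)) (lact s) F.
    rewrite /F; split=> [n c m m'|m c n n'|d m n] /=.
    + by rewrite mulrDl -scalerAl tensDl tensZl.
    + by rewrite mulrDl -scalerAl tensDr tensZr.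
    + by rewrite /lact -!mulrA tens_bal.
  have := congr1 (tlift F) (lcoprod_takeuchi H u b).
  rewrite !(raddf_tlift _ _ (tlift_linear F_bal)) => FE.
  transitivity (tlift (fun m n => tlift F (tens (m * t b) n : ltens H)) (D u)).
    by apply: eq_tlift => m n; rewrite tliftE // /F /lact mulrA.
  by rewrite FE; apply: eq_tlift => m n; rewrite tliftE // /F /lact mulrA.
Qed.

Lemma lgalois_bal : balanced (ract (t : A -> U)) (lact (t : A -> U))
  (fun u v => tlift (fun u1 u2 => tens u1 (u2 * v)) (D u) : ltens H).
Proof.
split=> [v c x y|u c x y|a u v] /=.
- by rewrite linearP; exact: (tlift_linear (lgalois_bal1 v)).
- rewrite /tlift scaler_sumr -big_split; apply: eq_bigr => -[m n] _ /=.
  by rewrite mulrDr -scalerAr tensDr tensZr.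
- rewrite /ract lcoprodMtgt (raddf_tlift _ _ (tlift_linear (lgalois_bal1 v))).
  apply: eq_tlift => x y; rewrite tliftE; last exact: lgalois_bal1.
  by rewrite /lact mulrA.
Qed.

Lemma lgalois_linear : linear (@lgalois _ _ _ H).
Proof. exact: (tlift_linear lgalois_bal). Qed.

Lemma lgaloisE u v :
  lgalois (tens u v : ltens_op H) = tlift (fun u1 u2 => tens u1 (u2 * v)) (D u).
Proof. exact: (tliftE lgalois_bal). Qed.

Lemma ltranslation_tgt u a :
  tlift (fun x y => tens (t a * x) y : ltens_op H) (tr u) =
  tlift (fun x y => tens x (y * t a) : ltens_op H) (tr u).
Proof.
apply: (bij_inj hopf); rewrite !(raddf_tlift _ _ lgalois_linear).
pose F x y : ltens H := tens x (t a * y).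
pose F' x y : ltens H := tens x (y * t a).
have F_bal : balanced (lact (t : A -> U)) (lact s) F.
  rewrite /F; split=> [n c m m'|m c n n'|d m n] /=.
  - by rewrite tensDl tensZl.
  - by rewrite mulrDr -scalerAr tensDr tensZr.
  - by rewrite tens_bal /lact !mulrA lsrc_tgt.
have F'_bal : balanced (lact (t : A -> U)) (lact s) F' by exact: lgalois_bal1.
transitivity (tlift F (lgalois (tr u))).
  rewrite /lgalois (raddf_tlift _ _ (tlift_linear F_bal)).
  apply: eq_tlift => x y; rewrite -/(lgalois _) lgaloisE lcoprod_tgt.
  rewrite !(raddf_tlift _ _ (tlift_linear (lgalois_bal1 y))).
  rewrite (raddf_tlift _ _ (tlift_linear F_bal)).
  apply: eq_tlift => x1 x2; rewrite !tliftE //; last exact: lgalois_bal1.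
  by rewrite /F mulrA.
transitivity (tlift F' (lgalois (tr u))).
  by rewrite ltranslationP // !tliftE // /F /F' mul1r mulr1.
rewrite /lgalois (raddf_tlift _ _ (tlift_linear F'_bal)).
apply: eq_tlift => x y; rewrite -/(lgalois _) lgaloisE.
rewrite (raddf_tlift _ _ (tlift_linear F'_bal)).
by apply: eq_tlift => x1 x2; rewrite tliftE // /F' mulrA.
Qed.

Lemma rharpP u phi a v : rharp_fun u phi (t a * v) = rharp_fun u phi v * a.
Proof.
have F_bal := rharp_balanced phi v.
have := congr1 (tlift (fun x y => eps (x * t (phi (y * v)))))
  (ltranslation_tgt u a).
rewrite !(raddf_tlift _ _ (tlift_linear F_bal)) => E.
rewrite /rharp_fun.
rewrite (@raddf_tlift _ _ _ _ _ _ _ _ (fun x : A => x * a)); last first.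
  by move=> c x y; rewrite mulrDl scalerAl.
transitivity (tlift (fun x y => tlift (fun x y => eps (x * t (phi (y * v))))
    (tens x (y * t a) : ltens_op H)) (tr u)).
  by apply: eq_tlift => x y; rewrite tliftE // mulrA.
rewrite -E; apply: eq_tlift => x y; rewrite tliftE //.
by rewrite -mulrA lcounit_tgt.
Qed.

(* v |-> (u -> phi)(v) = eps (u_+ t(phi(u_- v))), an element of the right dual *)
Definition rharp u phi : dual := RDual (rharp_linear u phi) (rharpP u phi).

End RightDual.

Section DualPairings.
Variables (k : comPzRingType) (A U : algType k) (H : leftBialgebroid A U).
Local Notation s := (lsrc H).
Local Notation t := (ltgt H).

Variable R : rightBialgebroid A (rdual H).

(* The map (u, v) |-> phi (u t(psi(v))) given by phi (x) psi *)
Definition rdual_pairing (T : rtens R) (u v : U) : A :=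
  tlift (fun phi psi : rdual H => phi (u * t (psi v))) T.

(* The map (u, v) |-> psi (s(phi(u)) v) given by phi (x) psi *)
Definition rdual_eval (T : rtens_op R) (u v : U) : A :=
  tlift (fun phi psi : rdual H => psi (s (phi u) * v)) T.

(* R is the standard right bialgebroid structure on the algebra U^*; the last
   two clauses express that the coproduct is determined by the pairing. *)
Definition is_right_dual : Prop :=
  [/\ forall (a : A) (u : U), rsrc R a u = lcounit H (u * s a),
      forall (a : A) (u : U), rtgt R a u = a * lcounit H u,
      forall phi : rdual H, rcounit R phi = phi 1,
      forall (phi : rdual H) (u v : U),
        rdual_pairing (rcoprod R phi) u v = phi (u * v)
    & forall T T' : rtens R,
        (forall u v, rdual_pairing T u v = rdual_pairing T' u v) -> T = T'].
End DualPairings.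

Definition is_dual_basis (k : comPzRingType) (A U : algType k)
    (H : leftBialgebroid A U) (n : nat) (e : 'I_n -> U)
    (e' : 'I_n -> rdual H) : Prop :=
  forall u : U, u = \sum_(i < n) ltgt H (e' i u) * e i.

(* Main.v *)
Require Import Defs.
From HB Require Import structures.
From mathcomp Require Import all_boot all_algebra.

Set Implicit Arguments.
Unset Strict Implicit.
Unset Printing Implicit Defensive.

Import GRing.Theory.

Local Open Scope ring_scope.

(** A finite dual basis e_i, e^i of U over A turns elements of the two tensor
    squares of U^* into functions of two variables. Since
      psi = sum_i e^i t^r(psi(e_i)),
    every T in U^* (x)_A U^* equals sum_i T(-, e_i) (x) e^i, where T(u, v)
    denotes the pairing, phi (u t(psi(v))) on phi (x) psi; and every S in
    U^* (x)_{A^op} U^* equals sum_i e^i (x) S(e_i, -), where S(u, v) denotes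
    psi (s(phi(u)) v) on phi (x) psi. Hence both functions determine the
    tensors ([dpair_inj], [deval_inj]).

    The coproduct of U^* is Delta_r(phi) = sum_i phi(- e_i) (x) e^i, the tensor
    whose pairing is (u, v) |-> phi(u v). By [dpair_inj] most axioms of a right
    bialgebroid become identities between functions on U; the multiplicativity
    of Delta_r expresses that of Delta, and coassociativity is a direct
    computation with the basis ([rdual_coassoc]).

    The Hopf-Galois map beta of U^* is the transpose of the one of U
    ([rgalois_transpose]):
      beta(S)(u, v) = S(u_(1), u_(2) v).
    As the Galois map alpha of U is bijective, and T(u, v) factors through
    U (x)_{A^op} U, the assignment T |-> T o alpha^-1 inverts beta: read as a
    function of (u, v), T o alpha^-1 is A-linear in v and balanced over A, so
    it does come from the element
    sum_i e^i (x) (T o alpha^-1)(e_i, -) of U^* (x)_{A^op} U^*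
    ([deval_rgalois_inv]). Finally alpha^-1(u (x) v) = u_+ (x) u_- v
    and the pairing of 1 (x) phi is (u, v) |-> eps(u t(phi(v))), so that
    beta^-1(1 (x) phi) is the function (u, v) |-> eps(u_+ t(phi(u_- v))). *)

(** * Maps out of tensor products *)

Section TensorSums.
Variables (k : comPzRingType) (M N W : lmodType k) (A : Type).
Variables (r : A -> M -> M) (l : A -> N -> N).

Lemma tlift_sum (f : M -> N -> W) (n : nat) (F : 'I_n -> tensor r l) :
  balanced r l f -> tlift f (\sum_(i < n) F i) = \sum_(i < n) tlift f (F i).
Proof.
move=> /tlift_linear f_lin; have fD (T T' : tensor r l) :
    tlift f (T + T') = tlift f T + tlift f T'.
  by have := f_lin 1 T T'; rewrite !scale1r.
apply: (big_morph _ fD); apply: (addrI (tlift f (0 : tensor r l))).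
by rewrite -fD !addr0.
Qed.

Lemma tlift_sum_tens (f : M -> N -> W) (n : nat)
    (x : 'I_n -> M) (y : 'I_n -> N) :
  balanced r l f ->
  tlift f (\sum_(i < n) tens (x i) (y i) : tensor r l) =
  \sum_(i < n) f (x i) (y i).
Proof.
by move=> fP; rewrite tlift_sum //; apply: eq_bigr => i _; rewrite tliftE.
Qed.

Lemma tens_linearl (y : N) : linear (fun x : M => tens x y : tensor r l).
Proof. by move=> c x x'; rewrite tensDl tensZl. Qed.

Lemma tens_linearr (x : M) : linear (fun y : N => tens x y : tensor r l).
Proof. by move=> c y y'; rewrite tensDr tensZr. Qed.

Lemma tens_suml (n : nat) (x : 'I_n -> M) (y : N) :
  tens (\sum_(i < n) x i) y = \sum_(i < n) tens (x i) y :> tensor r l.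
Proof.
apply: (big_morph (fun x : M => tens x y : tensor r l)) => [a b|].
  exact: tensDl.
by apply: (addrI (tens 0 y : tensor r l)); rewrite -tensDl !addr0.
Qed.

Lemma tens_sumr (n : nat) (x : M) (y : 'I_n -> N) :
  tens x (\sum_(i < n) y i) = \sum_(i < n) tens x (y i) :> tensor r l.
Proof.
apply: (big_morph (fun y : N => tens x y : tensor r l)) => [a b|].
  exact: tensDr.
by apply: (addrI (tens x 0 : tensor r l)); rewrite -tensDr !addr0.
Qed.

(** Sums may be moved in and out of [tlift] even for functions that are not
    balanced, since [tlift] is a sum over one fixed decomposition. *)
Lemma tlift_sumf (n : nat) (f : 'I_n -> M -> N -> W) (T : tensor r l) :
  tlift (fun x y => \sum_(i < n) f i x y) T = \sum_(i < n) tlift (f i) T.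
Proof. exact: exchange_big. Qed.

Lemma tlift_tens (h : tensor r l -> W) (T : tensor r l) :
  linear h -> tlift (fun x y => h (tens x y)) T = h T.
Proof.
by move=> h_lin; rewrite -(raddf_tlift _ _ h_lin) [in RHS](tensorE T).
Qed.

End TensorSums.

Arguments tens_linearl {k M N A r l} y.
Arguments tens_linearr {k M N A r l} x.

Lemma tlift_exchange (k : comPzRingType) (M N M' N' W : lmodType k)
    (A A' : Type) (r : A -> M -> M) (l : A -> N -> N) (r' : A' -> M' -> M')
    (l' : A' -> N' -> N') (f : M -> N -> M' -> N' -> W)
    (T : tensor r l) (T' : tensor r' l') :
  tlift (fun x y => tlift (f x y) T') T =
  tlift (fun x' y' => tlift (fun x y => f x y x' y') T) T'.
Proof. exact: exchange_big. Qed.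

(** * The algebra structure of the right dual *)

Section DualStructure.
Variables (k : comPzRingType) (A U : algType k) (H : leftBialgebroid A U).
Local Notation s := (lsrc H).
Local Notation t := (ltgt H).
Local Notation D := (lcoprod H).
Local Notation eps := (lcounit H).
Local Notation dual := (rdual H).

Implicit Types (phi psi chi : dual) (u v w : U) (a b : A).

Lemma rdual_sumE (n : nat) (F : 'I_n -> dual) u :
  (\sum_(i < n) F i) u = \sum_(i < n) F i u.
Proof. by apply: (big_morph (fun f : dual => f u)). Qed.

Lemma lcounit_tgt1 a : eps (t a) = a.
Proof. by have := lcounit_tgt H a 1; rewrite mulr1 lcounit1 mul1r. Qed.

Lemma lcounit_mul_src u a : eps (u * s a) = eps (u * t a).
Proof. by rewrite [RHS]lcounitMs lcounit_tgt1. Qed.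

(** u_(1) t(a) (x) u_(2) = u_(1) (x) u_(2) s(a), inside a balanced function. *)
Lemma tlift_takeuchi (W : lmodType k) (f : U -> U -> W) u a :
  balanced (lact (t : A -> U)) (lact s) f ->
  tlift (fun x y => f (x * t a) y) (D u) =
  tlift (fun x y => f x (y * s a)) (D u).
Proof.
move=> f_bal; have := congr1 (tlift f) (lcoprod_takeuchi H u a).
rewrite !(raddf_tlift _ _ (tlift_linear f_bal)) => E.
transitivity (tlift (fun x y => tlift f (tens (x * t a) y : ltens H)) (D u)).
  by apply: eq_tlift => x y; rewrite tliftE.
by rewrite E; apply: eq_tlift => x y; rewrite tliftE.
Qed.

Lemma rdual_shift_linear phi w : linear (fun u => phi (u * w)).
Proof. by move=> c u v; rewrite mulrDl -scalerAl linearP. Qed.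

Lemma rdual_shiftP phi w a u : phi (t a * u * w) = phi (u * w) * a.
Proof. by rewrite -mulrA rdualP. Qed.

(** The functional phi(- w). *)
Definition rdual_shift phi w : dual :=
  RDual (rdual_shift_linear phi w) (rdual_shiftP phi w).

Lemma rdual_shiftE phi w u : rdual_shift phi w u = phi (u * w).
Proof. by []. Qed.

(** The source map s^r(a) = eps(- s(a)) of the right dual. *)
Definition rdual_src a : dual := rdual_shift 1 (s a).

Lemma rdual_srcE a u : rdual_src a u = eps (u * s a).
Proof. by []. Qed.

Lemma rdual_tgt_linear a : linear (fun u => a * eps u).
Proof. by move=> c u v; rewrite linearP mulrDr scalerAr. Qed.

Lemma rdual_tgtP a b u : a * eps (t b * u) = a * eps u * b.
Proof. by rewrite lcounit_tgt mulrA. Qed.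

(** The target map t^r(a) = a eps(-) of the right dual. *)
Definition rdual_tgt a : dual := RDual (rdual_tgt_linear a) (rdual_tgtP a).

Lemma rdual_tgtE a u : rdual_tgt a u = a * eps u.
Proof. by []. Qed.

Lemma mul_rdual_src phi a : phi * rdual_src a = rdual_shift phi (t a).
Proof.
apply: rdual_eqP => u; rewrite rdual_mulE rdual_shiftE.
rewrite -(lcounit_r H (u * t a)) (raddf_tlift _ _ (rdual_linear phi)).
have bal : balanced (lact (t : A -> U)) (lact s)
    (fun x y => phi (t (eps y) * x)).
  split=> [y c x x'|x c y y'|b x y] /=.
  - by rewrite mulrDr -scalerAr linearP.
  - by rewrite !rdualP linearP mulrDr -scalerAr.
  - by rewrite /lact !rdualP lcounit_src mulrA.
rewrite lcoprodMtgt (raddf_tlift _ _ (tlift_linear bal)).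
apply: eq_tlift => x y; rewrite tliftE // rdual_srcE rdualP.
by rewrite -mulrA lcounit_src lcounit_mul_src.
Qed.

Lemma mul_rdual_srcl phi a u : (rdual_src a * phi) u = phi (u * s a).
Proof.
rewrite rdual_mulE.
have bal : balanced (lact (t : A -> U)) (lact s)
    (fun x y => phi (s (eps x) * y)).
  split=> [y c x x'|x c y y'|b x y] /=.
  - by rewrite !linearP mulrDl -scalerAl linearP.
  - by rewrite mulrDr -scalerAr linearP.
  - by rewrite /lact lcounit_tgt rmorphM mulrA.
transitivity (tlift (fun x y => phi (s (eps (x * t a)) * y)) (D u)).
  by apply: eq_tlift => x y; rewrite rdual_srcE lcounit_mul_src.
rewrite (tlift_takeuchi u a bal) -{2}(lcounit_l H u).
rewrite (@raddf_tlift _ _ _ _ _ _ _ _ (fun x : U => phi (x * s a))); last first.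
  exact: rdual_shift_linear.
by apply: eq_tlift => x y; rewrite mulrA.
Qed.

Lemma mul_rdual_tgt phi a u : (phi * rdual_tgt a) u = a * phi u.
Proof.
rewrite -{2}[phi](@mulr1 dual) !rdual_mulE.
rewrite (@raddf_tlift _ _ _ _ _ _ _ _ (fun x : A => a * x)) //.
by move=> c x y; rewrite mulrDr scalerAr.
Qed.

Lemma mul_rdual_tgtl phi a u : (rdual_tgt a * phi) u = phi (s a * u).
Proof.
rewrite rdual_mulE -{2}(lcounit_l H u).
rewrite (@raddf_tlift _ _ _ _ _ _ _ _ (fun x : U => phi (s a * x))); last first.
  by move=> c x y; rewrite mulrDr -scalerAr linearP.
by apply: eq_tlift => x y; rewrite rdual_tgtE rmorphM mulrA.
Qed.

(** The element s(phi(u_(1))) u_(2), so that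
    (phi psi)(u) = psi(rdual_hit phi u); see [rdual_mul_hit]. *)
Definition rdual_hit phi u : U := tlift (fun x y => s (phi x) * y) (D u).

Lemma rdual_mul_hit phi psi u : (phi * psi) u = psi (rdual_hit phi u).
Proof.
by rewrite rdual_mulE /rdual_hit (raddf_tlift _ _ (rdual_linear psi)).
Qed.

Lemma rdual_src_is_linear : linear rdual_src.
Proof.
move=> c a b; apply: rdual_eqP => u.
by rewrite rdual_addE rdual_scaleE !rdual_srcE linearP mulrDr -scalerAr linearP.
Qed.

Lemma rdual_src_is_monoid_morphism : monoid_morphism rdual_src.
Proof.
split=> [|a b]; apply: rdual_eqP => u.
  by rewrite rdual_srcE rmorph1 mulr1.
by rewrite mul_rdual_srcl !rdual_srcE rmorphM mulrA.
Qed.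

HB.instance Definition _ :=
  GRing.isLinear.Build k A dual *:%R rdual_src rdual_src_is_linear.
HB.instance Definition _ :=
  GRing.isMonoidMorphism.Build A dual rdual_src rdual_src_is_monoid_morphism.

(** [rdual_tgt] on the opposite algebra, where it is a ring morphism. *)
Definition rdual_tgt_op (a : A^c) : dual := rdual_tgt a.

Lemma rdual_tgt_is_zmod_morphism : zmod_morphism rdual_tgt_op.
Proof.
by move=> a b; apply: rdual_eqP => u; rewrite /= mulrBl.
Qed.

Lemma rdual_tgt_is_monoid_morphism : monoid_morphism rdual_tgt_op.
Proof.
split=> [|a b]; apply: rdual_eqP => u; first by rewrite rdual_tgtE mul1r.
by rewrite mul_rdual_tgt !rdual_tgtE mulrA.
Qed.

HB.instance Definition _ :=
  GRing.isZmodMorphism.Build A^c dual rdual_tgt_op rdual_tgt_is_zmod_morphism.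
HB.instance Definition _ :=
  GRing.isMonoidMorphism.Build A^c dual rdual_tgt_op
    rdual_tgt_is_monoid_morphism.

Lemma rdual_tgtZ (c : k) a : rdual_tgt_op (c *: a) = c *: rdual_tgt_op a.
Proof. by apply: rdual_eqP => u; rewrite rdual_scaleE !rdual_tgtE scalerAl. Qed.

Lemma rdual_src_tgt a b :
  rdual_src a * rdual_tgt_op b = rdual_tgt_op b * rdual_src a.
Proof.
apply: rdual_eqP => u; rewrite mul_rdual_tgt mul_rdual_tgtl !rdual_srcE.
by rewrite -mulrA lcounit_src.
Qed.

(** * The two tensor squares of the right dual as functions on U x U *)

(** U^* (x)_A U^* and U^* (x)_{A^op} U^*. *)
Definition dtens := tensor (ract rdual_src) (ract rdual_tgt).
Definition dtens_op := tensor (ract rdual_tgt) (lact rdual_tgt).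
HB.instance Definition _ := GRing.Lmodule.on dtens.
HB.instance Definition _ := GRing.Lmodule.on dtens_op.

Lemma dpair_balanced u v :
  balanced (ract rdual_src) (ract rdual_tgt)
    (fun phi psi : dual => phi (u * t (psi v))).
Proof.
split=> [psi c phi phi'|phi c psi psi'|a phi psi].
- by [].
- by rewrite /= rmorphD ltgtZ mulrDr -scalerAr linearP.
- by rewrite /ract mul_rdual_src rdual_shiftE mul_rdual_tgt rmorphM mulrA.
Qed.

(** The function T(u, v) attached to T in U^* (x)_A U^*. *)
Definition dpair (T : dtens) u v : A :=
  tlift (fun phi psi : dual => phi (u * t (psi v))) T.

Lemma dpairE phi psi u v : dpair (tens phi psi) u v = phi (u * t (psi v)).
Proof. exact: (tliftE (dpair_balanced u v)). Qed.

Lemma dpair_linear u v : linear (fun T => dpair T u v).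
Proof. exact: (tlift_linear (dpair_balanced u v)). Qed.

Lemma dpair_sum (n : nat) (x y : 'I_n -> dual) u v :
  dpair (\sum_(i < n) tens (x i) (y i)) u v = \sum_(i < n) x i (u * t (y i v)).
Proof. exact: (tlift_sum_tens _ _ (dpair_balanced u v)). Qed.

(** The functional T(-, v), built inside the k-module U^*. *)
Definition dslice (T : dtens) v : dual :=
  tlift (fun phi psi : dual => rdual_shift phi (t (psi v))) T.

Lemma dsliceE T u v : dslice T v u = dpair T u v.
Proof. exact: (@raddf_tlift _ _ _ _ _ _ _ _ (fun f : dual => f u)). Qed.

Lemma dslice_balanced v :
  balanced (ract rdual_src) (ract rdual_tgt)
    (fun phi psi : dual => rdual_shift phi (t (psi v))).
Proof.
split=> [psi c phi phi'|phi c psi psi'|a phi psi]; apply: rdual_eqP => u.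
- by case: (dpair_balanced u v) => + _ _; apply.
- by case: (dpair_balanced u v) => _ + _; apply.
- by case: (dpair_balanced u v) => _ _; apply.
Qed.

Lemma deval_balanced u v :
  balanced (ract rdual_tgt) (lact rdual_tgt)
    (fun phi psi : dual => psi (s (phi u) * v)).
Proof.
split=> [psi c phi phi'|phi c psi psi'|a phi psi].
- by rewrite /= !linearP mulrDl -scalerAl linearP.
- by [].
- by rewrite /ract /lact mul_rdual_tgt mul_rdual_tgtl rmorphM mulrA.
Qed.

(** The function S(u, v) attached to S in U^* (x)_{A^op} U^*. *)
Definition deval (T : dtens_op) u v : A :=
  tlift (fun phi psi : dual => psi (s (phi u) * v)) T.

Lemma deval_linear u v : linear (fun T => deval T u v).
Proof. exact: (tlift_linear (deval_balanced u v)). Qed.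

Lemma deval_sum (n : nat) (x y : 'I_n -> dual) u v :
  deval (\sum_(i < n) tens (x i) (y i)) u v = \sum_(i < n) y i (s (x i u) * v).
Proof. exact: (tlift_sum_tens _ _ (deval_balanced u v)). Qed.

(** The functional S(u, -); its value at v is psi (s(phi(u)) v) on phi (x) psi
    because t^r(a) psi = psi(s(a) -). *)
Definition dslice_op (T : dtens_op) u : dual :=
  tlift (fun phi psi : dual => rdual_tgt (phi u) * psi) T.

Lemma dslice_opE T u v : dslice_op T u v = deval T u v.
Proof.
rewrite /dslice_op (@raddf_tlift _ _ _ _ _ _ _ _ (fun f : dual => f v)) //.
by apply: eq_tlift => phi psi; rewrite mul_rdual_tgtl.
Qed.

Lemma dslice_op_balanced u :
  balanced (ract rdual_tgt) (lact rdual_tgt)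
    (fun phi psi : dual => rdual_tgt (phi u) * psi).
Proof.
split=> [psi c phi phi'|phi c psi psi'|a phi psi]; apply: rdual_eqP => v.
- rewrite !rdual_addE !rdual_scaleE !mul_rdual_tgtl.
  by case: (deval_balanced u v) => fl _ _; exact: (fl psi c phi phi').
- by rewrite mulrDr -scalerAr.
- by rewrite /ract /lact !mul_rdual_tgtl mul_rdual_tgt rmorphM mulrA.
Qed.

Section DualBasis.
Variables (n : nat) (e : 'I_n -> U) (e' : 'I_n -> dual).
Hypothesis dB : is_dual_basis e e'.

Lemma dual_basis_mul u v : \sum_(i < n) u * t (e' i v) * e i = u * v.
Proof.
by rewrite [in RHS](dB v) mulr_sumr; apply: eq_bigr => i _; rewrite mulrA.
Qed.

Lemma dual_basis_rdual phi u v :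
  \sum_(i < n) phi (u * t (e' i v) * e i) = phi (u * v).
Proof. by rewrite -dual_basis_mul linear_sum. Qed.

Lemma dual_basis_tgt psi : psi = \sum_(i < n) e' i * rdual_tgt (psi (e i)).
Proof.
apply: rdual_eqP => u; rewrite rdual_sumE [in LHS](dB u) linear_sum.
by apply: eq_bigr => i _; rewrite mul_rdual_tgt /= rdualP.
Qed.

Lemma dtens_basis (T : dtens) : T = \sum_(i < n) tens (dslice T (e i)) (e' i).
Proof.
elim/tensor_ind: T => [|phi psi|T T' IH IH'].
- rewrite big1 // => i _; have -> : dslice 0 (e i) = 0.
    apply: (addrI (dslice 0 (e i))).
    have := tlift_linear (dslice_balanced (e i)) 1 0 0.
    by rewrite !scale1r !addr0 => <-.
  by apply: (addrI (tens 0 (e' i) : dtens)); rewrite -tensDl !addr0.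
- rewrite {1}(dual_basis_tgt psi) tens_sumr; apply: eq_bigr => i _.
  rewrite /dslice tliftE; last exact: dslice_balanced.
  rewrite -mul_rdual_src; symmetry; exact: tens_bal.
- rewrite [in LHS]IH [in LHS]IH' -big_split; apply: eq_bigr => i _ /=.
  rewrite -tensDl; congr tens; apply: rdual_eqP => u.
  have := dpair_linear u (e i) 1 T T'; rewrite !scale1r => E.
  by rewrite rdual_addE !dsliceE E.
Qed.

Lemma dpair_inj (T T' : dtens) :
  (forall u v, dpair T u v = dpair T' u v) -> T = T'.
Proof.
move=> TT'; rewrite (dtens_basis T) (dtens_basis T'); apply: eq_bigr => i _.
by congr tens; apply: rdual_eqP => u; rewrite !dsliceE.
Qed.

Lemma dtens_op_basis (T : dtens_op) :
  T = \sum_(i < n) tens (e' i) (dslice_op T (e i)).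
Proof.
elim/tensor_ind: T => [|phi psi|T T' IH IH'].
- rewrite big1 // => i _; have -> : dslice_op 0 (e i) = 0.
    apply: (addrI (dslice_op 0 (e i))).
    have := tlift_linear (dslice_op_balanced (e i)) 1 0 0.
    by rewrite !scale1r !addr0 => <-.
  by apply: (addrI (tens (e' i) 0 : dtens_op)); rewrite -tensDr !addr0.
- rewrite {1}(dual_basis_tgt phi) tens_suml; apply: eq_bigr => i _.
  rewrite /dslice_op tliftE; last exact: dslice_op_balanced.
  exact: tens_bal.
- rewrite [in LHS]IH [in LHS]IH' -big_split; apply: eq_bigr => i _ /=.
  rewrite -tensDr; congr tens; apply: rdual_eqP => u.
  have := deval_linear (e i) u 1 T T'; rewrite !scale1r => E.
  by rewrite rdual_addE !dslice_opE E.
Qed.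

Lemma deval_inj (T T' : dtens_op) :
  (forall u v, deval T u v = deval T' u v) -> T = T'.
Proof.
move=> TT'; rewrite (dtens_op_basis T) (dtens_op_basis T').
apply: eq_bigr => i _; congr tens.
by apply: rdual_eqP => u; rewrite !dslice_opE.
Qed.

(** * The right bialgebroid structure *)

(** The coproduct sum_i phi(- e_i) (x) e^i. *)
Definition rdual_coprod phi : dtens :=
  \sum_(i < n) tens (rdual_shift phi (e i)) (e' i).

Lemma rdual_coprod_is_linear : linear rdual_coprod.
Proof.
move=> c phi psi; rewrite /rdual_coprod scaler_sumr -big_split.
apply: eq_bigr => i _ /=; rewrite -tensZl -tensDl; congr tens.
exact: rdual_eqP.
Qed.

HB.instance Definition _ :=
  GRing.isLinear.Build k dual dtens *:%R rdual_coprod rdual_coprod_is_linear.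

Lemma tlift_rdual_coprod (W : lmodType k) (f : dual -> dual -> W) phi :
  balanced (ract rdual_src) (ract rdual_tgt) f ->
  tlift f (rdual_coprod phi) = \sum_(i < n) f (rdual_shift phi (e i)) (e' i).
Proof. exact: tlift_sum_tens. Qed.

Lemma dpair_coprod phi u v : dpair (rdual_coprod phi) u v = phi (u * v).
Proof.
by rewrite dpair_sum -[RHS]dual_basis_rdual; apply: eq_bigr => i _.
Qed.

Lemma tens_map_balanced (f g : dual -> dual) :
  linear f -> linear g ->
  (forall x a, f (x * rdual_src a) = f x * rdual_src a) ->
  (forall y a, g (y * rdual_tgt a) = g y * rdual_tgt a) ->
  balanced (ract rdual_src) (ract rdual_tgt)
    (fun x y => tens (f x) (g y) : dtens).
Proof.
move=> f_lin g_lin fM gM; split=> [y c x x'|x c y y'|a x y].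
- by rewrite f_lin tens_linearl.
- by rewrite g_lin tens_linearr.
- by rewrite /ract fM gM; exact: tens_bal.
Qed.

Lemma mull_linear phi : linear ( *%R phi : dual -> dual).
Proof. by move=> c x y; rewrite mulrDr -scalerAr. Qed.

Lemma mulr_linear phi : linear (fun x : dual => x * phi).
Proof. by move=> c x y; rewrite mulrDl -scalerAl. Qed.

Lemma id_linear : linear (fun x : dual => x).
Proof. by []. Qed.

Lemma rdual_coprod_bimod a b phi :
  rdual_coprod (phi * (rdual_tgt_op a * rdual_src b)) =
  tlift (fun x y => tens (x * rdual_tgt_op a) (y * rdual_src b))
    (rdual_coprod phi).
Proof.
rewrite tlift_rdual_coprod; last first.
  apply: (tens_map_balanced (mulr_linear _) (mulr_linear _)) => x c /=.
    by rewrite -!mulrA rdual_src_tgt.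
  by rewrite -!mulrA -rdual_src_tgt.
apply: dpair_inj => u v; rewrite dpair_coprod dpair_sum mulrA mul_rdual_src.
rewrite rdual_shiftE mul_rdual_tgt -mulrA -dual_basis_rdual mulr_sumr.
by apply: eq_bigr => i _; rewrite mul_rdual_tgt mul_rdual_src.
Qed.

Lemma rdual_coprod_takeuchi phi b :
  tlift (fun x y => tens (rdual_src b * x) y : dtens) (rdual_coprod phi) =
  tlift (fun x y => tens x (rdual_tgt_op b * y)) (rdual_coprod phi).
Proof.
rewrite !tlift_rdual_coprod.
- apply: dpair_inj => u v; rewrite !dpair_sum.
  transitivity (phi (u * s b * v)).
    rewrite -dual_basis_rdual; apply: eq_bigr => i _.
    by rewrite mul_rdual_srcl rdual_shiftE -[u * _ * s b]mulrA -lsrc_tgt mulrA.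
  rewrite -mulrA -dual_basis_rdual; apply: eq_bigr => i _.
  by rewrite mul_rdual_tgtl rdual_shiftE.
- apply: (tens_map_balanced id_linear (mull_linear (rdual_tgt_op b))) => //.
  by move=> x a; rewrite mulrA.
- apply: (tens_map_balanced (mull_linear (rdual_src b)) id_linear) => //.
  by move=> x a; rewrite mulrA.
Qed.

Lemma rdual_counit_is_linear : linear (fun phi => phi 1).
Proof. by []. Qed.

(** The counit phi |-> phi(1). *)
Definition rdual_counit phi : A := phi 1.
HB.instance Definition _ :=
  GRing.isLinear.Build k dual A *:%R rdual_counit rdual_counit_is_linear.

Lemma rdual_counit_bimod a b phi :
  rdual_counit (phi * (rdual_tgt_op a * rdual_src b)) =
  a * rdual_counit phi * b.
Proof.
rewrite /rdual_counit mulrA mul_rdual_src rdual_shiftE mul_rdual_tgt.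
by rewrite mul1r -[t b]mulr1 rdualP mulrA.
Qed.

Lemma rdual_coprod_tgt a phi :
  rdual_coprod (phi * rdual_tgt a) =
  tensor_lact a (rdual_coprod phi).
Proof.
have := rdual_coprod_bimod a 1 phi; rewrite rmorph1 mulr1 => ->.
by apply: eq_tlift => x y; rewrite mulr1.
Qed.

Lemma rdual_coprod_src a phi :
  rdual_coprod (phi * rdual_src a) =
  tlift (fun x y => tens x (y * rdual_src a)) (rdual_coprod phi).
Proof.
have := rdual_coprod_bimod 1 a phi; rewrite rmorph1 mul1r => ->.
by apply: eq_tlift => x y; rewrite mulr1.
Qed.

Lemma tensor_lact_tens a phi psi :
  tensor_lact a (tens phi psi : dtens) = tens (phi * rdual_tgt a) psi :> dtens.
Proof.
rewrite /tensor_lact tliftE //.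
apply: (tens_map_balanced (mulr_linear (rdual_tgt a)) id_linear) => // x b.
by rewrite -!mulrA rdual_src_tgt.
Qed.

Local Notation dtens3 := (@tensor3 k dual A (ract rdual_src) (ract rdual_tgt)).

Lemma rdual_assoc_balanced chi : balanced (ract rdual_src) (ract rdual_tgt)
  (fun x y => tens x (tens y chi) : dtens3).
Proof.
split=> [y c x x'|x c y y'|a x y].
- exact: tens_linearl.
- by rewrite (tens_linearl chi) (tens_linearr x).
- rewrite {2}/ract -tensor_lact_tens; exact: tens_bal.
Qed.

(** Both sides are the sum over j, l of phi(- e_l e_j) (x) (e^l (x) e^j): for
    the right hand one, e^i(- e_j) is expanded in the dual basis and its
    coefficients e^i(e_l e_j) are moved to the first tensor factor. *)
Lemma rdual_coassoc :
  @coassociative k dual A (ract rdual_src) (ract rdual_tgt) rdual_coprod.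
Proof.
move=> phi; rewrite !tlift_rdual_coprod.
- transitivity (\sum_(j < n) \sum_(l < n)
    (tens (rdual_shift (rdual_shift phi (e j)) (e l)) (tens (e' l) (e' j))
       : dtens3)).
    apply: eq_bigr => j _; rewrite tlift_rdual_coprod //.
    exact: rdual_assoc_balanced.
  transitivity (\sum_(i < n) \sum_(j < n) \sum_(l < n)
    (tens (rdual_shift phi (e i) * rdual_src (e' i (e l * e j)))
       (tens (e' l) (e' j)) : dtens3)).
    rewrite [RHS]exchange_big; apply: eq_bigr => j _.
    rewrite [RHS]exchange_big; apply: eq_bigr => l _ /=.
    rewrite -tens_suml; congr tens; apply: rdual_eqP => u.
    rewrite rdual_sumE !rdual_shiftE -mulrA -dual_basis_rdual.
    by apply: eq_bigr => i _; rewrite mul_rdual_src.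
  apply: eq_bigr => i _; rewrite /rdual_coprod tens_sumr.
  apply: eq_bigr => j _.
  rewrite [in RHS](dual_basis_tgt (rdual_shift (e' i) _)) tens_suml tens_sumr.
  apply: eq_bigr => l _.
  rewrite rdual_shiftE -tensor_lact_tens; exact: tens_bal.
- split=> [y c x x'|x c y y'|a x y].
  + exact: tens_linearl.
  + by rewrite linearP tens_linearr.
  + rewrite [in RHS]/ract rdual_coprod_tgt; exact: tens_bal.
- split=> [y c x x'|x c y y'|a x y].
  + by rewrite linearP; exact: (tlift_linear (rdual_assoc_balanced y)).
  + rewrite /tlift scaler_sumr -big_split; apply: eq_bigr => -[p q] _ /=.
    by rewrite (tens_linearr q) (tens_linearr p).
  + rewrite [in LHS]/ract rdual_coprod_src.
    rewrite (raddf_tlift _ _ (tlift_linear (rdual_assoc_balanced y))).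
    apply: eq_tlift => p q; rewrite tliftE; last exact: rdual_assoc_balanced.
    by congr tens; exact: tens_bal.
Qed.

Lemma rdual_counit_l phi :
  tlift (fun x y => y * rdual_tgt_op (rdual_counit x)) (rdual_coprod phi) = phi.
Proof.
rewrite tlift_rdual_coprod; last first.
  split=> [y c x x'|x c y y'|a x y].
  - apply: rdual_eqP => u.
    by rewrite rdual_addE rdual_scaleE !mul_rdual_tgt linearP mulrDl -scalerAl.
  - exact: mulr_linear.
  - apply: rdual_eqP => u; rewrite /ract !mul_rdual_tgt /rdual_counit.
    by rewrite mul_rdual_src rdual_shiftE mul1r -[t a]mulr1 rdualP mulrA.
rewrite [RHS]dual_basis_tgt; apply: eq_bigr => i _.
by rewrite /rdual_counit rdual_shiftE mul1r.
Qed.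

Lemma rdual_counit_r phi :
  tlift (fun x y => x * rdual_src (rdual_counit y)) (rdual_coprod phi) = phi.
Proof.
rewrite tlift_rdual_coprod; last first.
  split=> [y c x x'|x c y y'|a x y].
  - exact: mulr_linear.
  - by rewrite !linearP mulrDr -scalerAr.
  - by rewrite /ract /rdual_counit mul_rdual_tgt rmorphM mulrA.
apply: rdual_eqP => u; rewrite rdual_sumE -[in RHS](mulr1 u) -dual_basis_rdual.
by apply: eq_bigr => i _; rewrite mul_rdual_src.
Qed.

Lemma rdual_coprod1 : rdual_coprod 1 = tens 1 1.
Proof.
by apply: dpair_inj => u v; rewrite dpair_coprod dpairE !rdual_oneE lcounitMt.
Qed.

(** The pairing of both sides at (u, v) is
    psi (s(phi(u_(1) v_(1))) u_(2) v_(2)). *)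
Lemma rdual_coprodM phi psi :
  rdual_coprod (phi * psi) =
  tlift (fun x1 x2 =>
    tlift (fun y1 y2 => tens (x1 * y1) (x2 * y2)) (rdual_coprod psi))
    (rdual_coprod phi).
Proof.
rewrite tlift_rdual_coprod; last first.
  split=> [y c x x'|x c y y'|a x y].
  - rewrite /tlift scaler_sumr -big_split; apply: eq_bigr => -[p q] _ /=.
    by rewrite mulrDl -scalerAl tens_linearl.
  - rewrite /tlift scaler_sumr -big_split; apply: eq_bigr => -[p q] _ /=.
    by rewrite mulrDl -scalerAl tens_linearr.
  (* The outer function is balanced by the Takeuchi property of Delta_r(psi). *)
  - have bal := tens_map_balanced (mull_linear x) (mull_linear y)
      (fun _ _ => mulrA _ _ _) (fun _ _ => mulrA _ _ _).
    have := congr1 (tlift (fun p q => tens (x * p) (y * q) : dtens))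
      (rdual_coprod_takeuchi psi a).
    rewrite !(raddf_tlift _ _ (tlift_linear bal)) => E.
    transitivity (tlift (fun p q =>
        tlift (fun p q => tens (x * p) (y * q) : dtens)
          (tens (rdual_src a * p) q : dtens)) (rdual_coprod psi)).
      by apply: eq_tlift => p q; rewrite tliftE // /ract mulrA.
    by rewrite E; apply: eq_tlift => p q; rewrite tliftE // /ract mulrA.
transitivity (\sum_(i < n) \sum_(j < n)
    tens (rdual_shift phi (e i) * rdual_shift psi (e j)) (e' i * e' j) : dtens);
    last first.
  apply: eq_bigr => i _; rewrite tlift_rdual_coprod //.
  apply: (tens_map_balanced (mull_linear _) (mull_linear _)) => *;
    by rewrite mulrA.
apply: dpair_inj => u v; rewrite dpair_coprod /dpair.
(* The right hand side is the sum over i of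
   psi (s(phi(u_(1) e_i)) u_(2) s(e^i(v_(1))) v_(2)): the sum over j
   reconstructs [rdual_hit (e' i) v] from its coordinates. *)
rewrite (tlift_sum _ (dpair_balanced u v)).
pose G i (x y w : U) := psi (s (phi (x * e i)) * (y * w)).
have G_bal i w : balanced (lact (t : A -> U)) (lact s) (fun x y => G i x y w).
  rewrite /G; split=> [y c x x'|x c y y'|a x y].
  - by rewrite mulrDl -scalerAl !linearP mulrDl -scalerAl linearP.
  - by rewrite mulrDl -scalerAl mulrDr -scalerAr linearP.
  - by rewrite /lact -mulrA rdualP rmorphM !mulrA.
transitivity (tlift (fun x y =>
    \sum_(i < n) G i x y (rdual_hit (e' i) v)) (D u)); last first.
  rewrite tlift_sumf; apply: eq_bigr => i _.
  rewrite (tlift_sum_tens _ _ (dpair_balanced u v)).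
  transitivity (tlift (fun x y => \sum_(j < n)
      G i x y (t (e' j (rdual_hit (e' i) v)) * e j)) (D u)).
    apply: eq_tlift => x y; rewrite /G.
    by rewrite [in LHS](dB (rdual_hit (e' i) v)) !mulr_sumr linear_sum.
  rewrite tlift_sumf; apply: eq_bigr => j _.
  rewrite [in RHS]rdual_mulE lcoprodMtgt.
  rewrite (raddf_tlift _ _ (tlift_linear (rdual_mul_balanced _ _))).
  apply: eq_tlift => x y; rewrite tliftE; last exact: rdual_mul_balanced.
  by rewrite !rdual_shiftE rdual_mul_hit /G !mulrA.
transitivity (tlift (fun x' y' =>
    tlift (fun x y => \sum_(i < n) G i x y (s (e' i x') * y')) (D u)) (D v));
    last first.
  rewrite [RHS](tlift_sumf (fun i x y => G i x y (rdual_hit (e' i) v))).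
  rewrite (eq_tlift _ (fun x' y' =>
    tlift_sumf (fun i x y => G i x y (s (e' i x') * y')) (D u))).
  rewrite tlift_sumf; apply: eq_bigr => i _.
  rewrite tlift_exchange; apply: eq_tlift => x y.
  rewrite /G (@raddf_tlift _ _ _ _ _ _ _ _
    (fun w : U => psi (s (phi (x * e i)) * (y * w)))) //.
  by move=> c w w'; rewrite mulrDr -scalerAr mulrDr -scalerAr linearP.
rewrite rdual_mulE lcoprodM.
rewrite (raddf_tlift _ _ (tlift_linear (rdual_mul_balanced _ _))).
apply: eq_tlift => x' y'.
rewrite (raddf_tlift _ _ (tlift_linear (rdual_mul_balanced _ _))).
rewrite tlift_sumf.
(* The factor s(e^i(v_(1))) passes to t(e^i(v_(1))) on u_(1), where the sum
   over i gives u_(1) v_(1). *)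
transitivity (\sum_(i < n) tlift (fun x y => G i (x * t (e' i x')) y y') (D u)).
  rewrite -tlift_sumf; apply: eq_tlift => x y.
  rewrite tliftE; last exact: rdual_mul_balanced.
  rewrite -(dual_basis_rdual phi x x') raddf_sum mulr_suml linear_sum.
  by apply: eq_bigr => i _.
apply: eq_bigr => i _; rewrite (tlift_takeuchi _ _ (G_bal i y')).
by apply: eq_tlift => x y; rewrite /G -[y * _ * y']mulrA.
Qed.

Lemma rdual_counit_mul_src phi psi :
  rdual_counit (phi * psi) = rdual_counit (rdual_src (rdual_counit phi) * psi).
Proof.
rewrite /rdual_counit mul_rdual_srcl mul1r rdual_mulE lcoprod1.
by rewrite tliftE ?mulr1; last exact: rdual_mul_balanced.
Qed.

Lemma rdual_counit_mul_tgt phi psi :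
  rdual_counit (phi * psi) =
  rdual_counit (rdual_tgt_op (rdual_counit phi) * psi).
Proof.
rewrite rdual_counit_mul_src /rdual_counit mul_rdual_srcl mul_rdual_tgtl.
by rewrite mul1r mulr1.
Qed.

(** The right bialgebroid U^*. The dual basis enters the coproduct, which
    nevertheless does not depend on it by [dpair_coprod] and [dpair_inj]. *)
Definition rdual_bialgebroid : rightBialgebroid A dual :=
  @RightBialgebroid k A dual rdual_src rdual_tgt_op rdual_tgtZ rdual_src_tgt
    rdual_coprod rdual_counit rdual_coprod_bimod rdual_counit_bimod
    rdual_coassoc rdual_counit_l rdual_counit_r rdual_coprod_takeuchi
    rdual_coprod1 rdual_coprodM (lcounit1 H) rdual_counit_mul_src
    rdual_counit_mul_tgt.
Local Notation R := rdual_bialgebroid.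

Lemma rdual_bialgebroid_right_dual : is_right_dual R.
Proof.
split=> //; first by move=> phi u v; exact: dpair_coprod.
by move=> T T'; exact: dpair_inj.
Qed.

(** * The Hopf-Galois map of the right dual *)

(** The function T(u, v) factors through U (x)_{A^op} U. *)
Lemma dpair_transpose_balanced (T : dtens) :
  balanced (ract (t : A -> U)) (lact (t : A -> U)) (dpair T).
Proof.
split=> [v c u u'|u c v v'|a u v].
- rewrite /dpair /tlift scaler_sumr -big_split; apply: eq_bigr => -[p q] _ /=.
  by rewrite mulrDl -scalerAl linearP.
- rewrite /dpair /tlift scaler_sumr -big_split; apply: eq_bigr => -[p q] _ /=.
  by rewrite linearP rmorphD ltgtZ mulrDr -scalerAr linearP.
- apply: eq_tlift => p q; rewrite /ract /lact rdualP rmorphM.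
  by rewrite mulrA.
Qed.

(** The function S(u, v) factors through U (x)_A U. *)
Lemma deval_transpose_balanced (S : dtens_op) :
  balanced (lact (t : A -> U)) (lact s) (deval S).
Proof.
split=> [v c u u'|u c v v'|a u v].
- rewrite /deval /tlift scaler_sumr -big_split; apply: eq_bigr => -[p q] _ /=.
  by rewrite !linearP mulrDl -scalerAl linearP.
- rewrite /deval /tlift scaler_sumr -big_split; apply: eq_bigr => -[p q] _ /=.
  by rewrite mulrDr -scalerAr linearP.
- by apply: eq_tlift => p q; rewrite /lact rdualP rmorphM mulrA.
Qed.

Lemma dpair_tgtl T a u v : dpair T (t a * u) v = dpair T u v * a.
Proof.
rewrite [RHS](@raddf_tlift _ _ _ _ _ _ _ _ (fun x : A => x * a)); last first.
  by move=> c x y; rewrite mulrDl scalerAl.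
by apply: eq_tlift => p q; rewrite -mulrA rdualP.
Qed.

(** The Galois map of U^* is the transpose of the Galois map of U. *)
Lemma rgalois_transpose (S : dtens_op) (X : ltens_op H) :
  tlift (dpair (rgalois (S : rtens_op R))) X = tlift (deval S) (lgalois X).
Proof.
rewrite /lgalois (raddf_tlift _ _ (tlift_linear (deval_transpose_balanced S))).
apply: eq_tlift => u v.
rewrite (raddf_tlift _ _ (tlift_linear (deval_transpose_balanced S))).
rewrite /rgalois (raddf_tlift _ _ (dpair_linear u v)).
transitivity (tlift (fun x y => deval S x (y * v)) (D u)); last first.
  by apply: eq_tlift => x y; rewrite tliftE //; exact: deval_transpose_balanced.
rewrite tlift_exchange; apply: eq_tlift => phi psi.
rewrite tlift_rdual_coprod; last first.
  apply: (tens_map_balanced (mull_linear _) id_linear) => // x a.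
  by rewrite mulrA.
rewrite dpair_sum.
transitivity (\sum_(i < n) tlift (fun x y =>
    psi (s (phi x) * y * t (e' i v) * e i)) (D u)).
  apply: eq_bigr => i _; rewrite rdual_mulE lcoprodMtgt.
  rewrite (raddf_tlift _ _ (tlift_linear (rdual_mul_balanced _ _))).
  apply: eq_tlift => x y; rewrite tliftE; last exact: rdual_mul_balanced.
  by rewrite rdual_shiftE !mulrA.
rewrite -tlift_sumf; apply: eq_tlift => x y.
by rewrite dual_basis_rdual !mulrA.
Qed.

Hypothesis hopf : is_left_Hopf H.

Lemma lgalois_lact a (X : ltens_op H) :
  lgalois (tlift (fun x y => tens (t a * x) y : ltens_op H) X) =
  tlift (fun x y => tens x (t a * y)) (lgalois X).
Proof.
have bal : balanced (lact (t : A -> U)) (lact s)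
    (fun x y => tens x (t a * y) : ltens H).
  split=> [y c x x'|x c y y'|b x y].
  - exact: tens_linearl.
  - by rewrite mulrDr -scalerAr tens_linearr.
  - by rewrite /lact mulrA -lsrc_tgt -mulrA; exact: tens_bal.
rewrite (raddf_tlift _ _ (@lgalois_linear _ _ _ H)).
rewrite [in RHS]/lgalois (raddf_tlift _ _ (tlift_linear bal)).
apply: eq_tlift => x y; rewrite lgaloisE lcoprod_tgt.
rewrite !(raddf_tlift _ _ (tlift_linear (lgalois_bal1 H y))).
rewrite (raddf_tlift _ _ (tlift_linear bal)).
apply: eq_tlift => p q; rewrite !tliftE //; last exact: lgalois_bal1.
by rewrite mulrA.
Qed.

Lemma lgalois_ract w (X : ltens_op H) :
  lgalois (tlift (fun x y => tens x (y * w) : ltens_op H) X) =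
  tlift (fun x y => tens x (y * w)) (lgalois X).
Proof.
have bal := lgalois_bal1 H w.
rewrite (raddf_tlift _ _ (@lgalois_linear _ _ _ H)).
rewrite [in RHS]/lgalois (raddf_tlift _ _ (tlift_linear bal)).
apply: eq_tlift => x y; rewrite lgaloisE.
rewrite (raddf_tlift _ _ (tlift_linear bal)).
by apply: eq_tlift => p q; rewrite !tliftE // mulrA.
Qed.

Section Inverse.
Variables (g : ltens H -> ltens_op H).
Hypotheses (gK : cancel (@lgalois _ _ _ H) g)
           (Kg : cancel g (@lgalois _ _ _ H)).

Lemma lgalois_inv_linear : linear g.
Proof. by move=> c X Y; apply: (can_inj gK); rewrite lgalois_linear !Kg. Qed.

Lemma lgalois_inv_ltranslation u v :
  g (tens u v) =
  tlift (fun x y => tens x (y * v) : ltens_op H) (ltranslation H u).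
Proof.
apply: (can_inj gK); rewrite Kg lgalois_ract ltranslationP // tliftE ?mul1r //.
exact: lgalois_bal1.
Qed.

(** The function (u, v) |-> (T o alpha^-1)(u (x) v), where g = alpha^-1 is the
    inverse of the Galois map of U. *)
Definition dtranspose (T : dtens) u v : A := tlift (dpair T) (g (tens u v)).

Lemma dtranspose_linear T u : linear (dtranspose T u).
Proof.
move=> c v w; rewrite /dtranspose tens_linearr lgalois_inv_linear.
exact: (tlift_linear (dpair_transpose_balanced T)).
Qed.

(** This holds because alpha intertwines t(a) acting on the first tensor
    factor with t(a) acting on the second one. *)
Lemma dtransposeP T u a v : dtranspose T u (t a * v) = dtranspose T u v * a.
Proof.
rewrite /dtranspose.
have -> : g (tens u (t a * v)) =
    tlift (fun x y => tens (t a * x) y : ltens_op H) (g (tens u v)).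
  apply: (can_inj gK); rewrite lgalois_lact !Kg tliftE //.
  split=> [y c x x'|x c y y'|b x y].
  - exact: tens_linearl.
  - by rewrite mulrDr -scalerAr tens_linearr.
  - by rewrite /lact mulrA -lsrc_tgt -mulrA; exact: tens_bal.
rewrite (raddf_tlift _ _ (tlift_linear (dpair_transpose_balanced T))).
rewrite [RHS](@raddf_tlift _ _ _ _ _ _ _ _ (fun x : A => x * a)); last first.
  by move=> c x y; rewrite mulrDl scalerAl.
apply: eq_tlift => x y; rewrite tliftE; last exact: dpair_transpose_balanced.
exact: dpair_tgtl.
Qed.

Definition dtranspose_rdual T u : dual :=
  RDual (dtranspose_linear T u) (dtransposeP T u).

(** The inverse of the Galois map of U^*. *)
Definition rgalois_inv (T : dtens) : dtens_op :=
  \sum_(i < n) tens (e' i) (dtranspose_rdual T (e i)).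

Lemma deval_rgalois_inv T u v : deval (rgalois_inv T) u v = dtranspose T u v.
Proof.
rewrite deval_sum /= /dtranspose [in RHS](dB u) tens_suml.
have gsum (X : 'I_n -> ltens H) : g (\sum_(i < n) X i) = \sum_(i < n) g (X i).
  apply: (can_inj gK); rewrite Kg.
  have lD : {morph @lgalois _ _ _ H : x y / x + y}.
    by move=> x y; have := lgalois_linear 1 x y; rewrite !scale1r.
  rewrite (big_morph _ lD (id1 := 0)).
    by apply: eq_bigr => i _; rewrite Kg.
  by apply: (addrI (lgalois (0 : ltens_op H))); rewrite -lD !addr0.
rewrite gsum tlift_sum; last exact: dpair_transpose_balanced.
by apply: eq_bigr => i _; congr (tlift _ (g _)); rewrite -tens_bal.
Qed.

Lemma rgalois_invK : cancel (@rgalois _ _ _ R) rgalois_inv.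
Proof.
move=> S; apply: deval_inj => u v; rewrite deval_rgalois_inv /dtranspose.
rewrite rgalois_transpose Kg tliftE //; exact: deval_transpose_balanced.
Qed.

Lemma rgaloisK : cancel rgalois_inv (@rgalois _ _ _ R).
Proof.
move=> T; apply: dpair_inj => u v.
have := rgalois_transpose (rgalois_inv T) (tens u v : ltens_op H).
rewrite tliftE; last exact: dpair_transpose_balanced.
move=> ->.
transitivity (tlift (dtranspose T) (lgalois (tens u v : ltens_op H))).
  by apply: eq_tlift => x y; exact: deval_rgalois_inv.
rewrite (tlift_tens (h := fun X => tlift (dpair T) (g X))).
  by rewrite gK tliftE //; exact: dpair_transpose_balanced.
move=> c X Y; rewrite lgalois_inv_linear.
exact: (tlift_linear (dpair_transpose_balanced T)).
Qed.

Lemma dtranspose_one phi u v : dtranspose (tens 1 phi) u v = rharp hopf u phi v.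
Proof.
rewrite /dtranspose lgalois_inv_ltranslation.
rewrite (raddf_tlift _ _ (tlift_linear (dpair_transpose_balanced _))).
apply: eq_tlift => x y; rewrite tliftE; last exact: dpair_transpose_balanced.
by rewrite dpairE.
Qed.

End Inverse.

Lemma rdual_bialgebroid_right_Hopf : is_right_Hopf R.
Proof.
case: hopf => g gK Kg; exists (rgalois_inv gK Kg).
  exact: rgalois_invK.
exact: rgaloisK.
Qed.

Lemma deval_rtranslation phi u v :
  deval (rtranslation R phi) u v = rharp hopf u phi v.
Proof.
have RH := rdual_bialgebroid_right_Hopf.
case: (hopf) => g gK Kg.
have -> : rtranslation R phi = rgalois_inv gK Kg (tens 1 phi).
  by apply: (bij_inj RH); rewrite rtranslationP // rgaloisK.
by rewrite deval_rgalois_inv dtranspose_one.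
Qed.

End DualBasis.

Lemma rtranslation_dual_basis (n m : nat) (e : 'I_n -> U) (e' : 'I_n -> dual)
    (f : 'I_m -> U) (f' : 'I_m -> dual) (dB : is_dual_basis e e')
    (hopf : is_left_Hopf H) phi :
  is_dual_basis f f' ->
  rtranslation (rdual_bialgebroid dB) phi =
  \sum_(i < m) tens (f' i) (rharp hopf (f i) phi).
Proof.
move=> dF; rewrite [LHS](dtens_op_basis dF); apply: eq_bigr => i _.
by congr tens; apply: rdual_eqP => u; rewrite dslice_opE deval_rtranslation.
Qed.

End DualStructure.

(** * Existence of a dual basis *)

Section DualBasisExistence.
Variables (k : comPzRingType) (A U : algType k) (H : leftBialgebroid A U).
Local Notation t := (ltgt H).

(** A finitely generated projective module has a finite dual basis. *)
Lemma dual_basis_exists :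
  finitely_generated (tgt_mod H) -> projective (tgt_mod H) ->
  exists (n : nat) (e : 'I_n -> U) (e' : 'I_n -> rdual H), is_dual_basis e e'.
Proof.
move=> [n [e e_gen]] projU; exists n, e.
pose g (c : 'rV[A^c]_n) : tgt_mod H := \sum_(i < n) c 0 i *: e i.
have g_lin : linear g.
  move=> a c d; rewrite /g scaler_sumr -big_split; apply: eq_bigr => i _ /=.
  by rewrite !mxE scalerDl scalerA.
pose gL := GRing.isLinear.Build _ _ _ _ g g_lin.
pose G : {linear 'rV[A^c]_n -> tgt_mod H} := HB.pack g gL.
have [|h hK] := projU _ _ G (idfun : {linear tgt_mod H -> tgt_mod H}).
  move=> u; have [c ->] := e_gen u; exists (\row_i c i).
  by apply: eq_bigr => i _; rewrite mxE.
(* The e^i are the coordinates of a section of the surjection from the free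
   module. *)
pose f (i : 'I_n) (u : U) : A := h u 0 i.
have f_tgt i (a : A) u : f i (t a * u) = f i u * a.
  have := congr1 (fun M : 'rV[A^c]_n => M 0 i)
    (linearZ_LR h (a : A^c) (u : tgt_mod H)).
  by rewrite mxE => E; exact: E.
have f_add i u v : f i (u + v) = f i u + f i v.
  have := congr1 (fun M : 'rV[A^c]_n => M 0 i) (raddfD h (u : tgt_mod H) v).
  by rewrite mxE => E; exact: E.
(* The scalars from k act through t, so A-linearity implies k-linearity. *)
have f_lin i : linear (f i).
  move=> c u v; rewrite f_add; congr (_ + _).
  have -> : c *: u = t (c *: 1) * u by rewrite ltgtZ rmorph1 -scalerAl mul1r.
  by rewrite f_tgt -scalerAr mulr1.
by exists (fun i => RDual (f_lin i) (f_tgt i)) => u; rewrite -[LHS]hK.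
Qed.

End DualBasisExistence.

Theorem theorem1p1 (k : comPzRingType) (A U : algType k)
    (H : leftBialgebroid A U) (hopf : is_left_Hopf H)
    (fgU : finitely_generated (tgt_mod H)) (projU : projective (tgt_mod H)) :
  exists R : rightBialgebroid A (rdual H),
    [/\ is_right_dual R,
        is_right_Hopf R,
        (forall T T' : rtens_op R,
           (forall u v : U, rdual_eval T u v = rdual_eval T' u v) -> T = T'),
        (forall (phi : rdual H) (u v : U),
           rdual_eval (rtranslation R phi) u v = rharp hopf u phi v)
      & forall (n : nat) (e : 'I_n -> U) (e' : 'I_n -> rdual H),
          is_dual_basis e e' ->
          forall phi : rdual H,
            rtranslation R phi =
            \sum_(i < n) (tens (e' i) (rharp hopf (e i) phi) : rtens_op R)].
Proof.
have [n [e [e' dB]]] := dual_basis_exists fgU projU.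
exists (rdual_bialgebroid dB); split.
- exact: rdual_bialgebroid_right_dual.
- exact: rdual_bialgebroid_right_Hopf.
- by move=> T T'; exact: (deval_inj dB).
- by move=> phi u v; exact: deval_rtranslation.
- by move=> m f f' dF phi; exact: rtranslation_dual_basis.
Qed.
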